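(* Let $\Gamma$ be an $n$-dimensional Bieberbach group of diagonal type with holonomy group isomorphic to $C_2^2$, and let $k=b_1(\Gamma)$ be its first Betti number. Then $\Gamma$ is non-diffuse if and only if $$\Gamma\cong Z(\Gamma)\oplus\left(\mathbb{Z}^{n-k-3}\rtimes\Delta_P\right)$$ (for some semidirect product of $\mathbb{Z}^{n-k-3}$ by $\Delta_P$), where $Z(\Gamma)$ is the center of $\Gamma$ and $\Delta_P$ is the 3-dimensional non-diffuse Hantzsche-Wendt group.
   Context: An $n$-dimensional crystallographic group is a discrete cocompact subgroup $\Gamma$ of $\mathrm{Isom}(\mathbb{E}^n)=O(n)\ltimes\mathbb{R}^n$. Its lattice subgroup is $\Gamma\cap\mathbb{R}^n\cong\mathbb{Z}^n$; its holonomy group is the finite group $G=\Gamma/(\Gamma\cap\mathbb{R}^n)$, and the conjugation action of $G$ on the lattice subgroup is the (faithful) holonomy representation $G\to\mathrm{GL}_n(\mathbb{Z})$. A Bieberbach group is a torsion-free crystallographic group. A crystallographic group is of diagonal type if it is isomorphic to a crystallographic group whose holonomy representation is diagonal (equivalently, the lattice subgroup has a $\mathbb{Z}$-basis $e_1,\dots,e_n$ with $g\cdot e_i=\pm e_i$ for all $g\in G$ and all $i$). Diffuseness: for a group $H$ and a subset $A\subseteq H$, an element $a\in A$ is an extremal point of $A$ if for all $g\in H\smallsetminus\{1\}$ either $ga\notin A$ or $g^{-1}a\notin A$. The group $H$ is diffuse if every finite subset $A\subseteq H$ with $|A|\geq 2$ has at least two extremal points; it is non-diffuse if it is not diffuse.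 The first Betti number $b_1(\Gamma)$ is the torsion-free rank of $\Gamma/[\Gamma,\Gamma]$. The group $\Delta_P$ (also called the Promislow group or Passman group) is $$\Delta_P=\langle x,y\mid x^{-1}y^2xy^2=y^{-1}x^2yx^2=1\rangle .$$ *)

(* Defs.v *)
From HB Require Import structures.
From mathcomp Require Import all_boot all_order all_algebra finmap.
From mathcomp Require Import all_classical all_reals topology normedtype.
Import numFieldNormedType.Exports.
Import GRing.Theory.

Set Implicit Arguments.
Unset Strict Implicit.
Unset Printing Implicit Defensive.

Local Open Scope quotient_scope.
Local Open Scope group_scope.

Definition isomorphic (G H : groupType) : Prop :=
  exists f : {multiplicative G -> H}, bijective f.

Definition torsion_free (G : groupType) : Prop :=
  forall (x : G) (n : nat), x ^+ n.+1 = 1 -> x = 1.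

Section Diffuse.
Variable H : groupType.

Definition extremal (A : {fset H}) (a : H) : Prop :=
  a \in A /\ forall g : H, g != 1 -> (g * a \notin A) || (g^-1 * a \notin A).

Definition diffuse : Prop :=
  forall A : {fset H}, (2 <= #|` A|)%N ->
    exists a b : H, [/\ a != b, extremal A a & extremal A b].

End Diffuse.

(* Subgroups are the boolean predicates with a [groupClosed] structure;
   [subgroup S] is the group carried by such a predicate. *)
Definition subgroup (G : groupType) (S : groupClosed G) : Type :=
  {x : G | x \in S}.

Section Subgroup.
Variables (G : groupType) (S : groupClosed G).

HB.instance Definition _ := SubType.on (subgroup S).
HB.instance Definition _ := Choice.on (subgroup S).

Lemma subgroup_closed : group_closed S.
Proof. by split; [exact: gpred1 | move=> x y; exact: gpredF]. Qed.

HB.instance Definition _ :=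
  SubChoice_isSubGroup.Build G (mem S) (subgroup S) subgroup_closed.

End Subgroup.

HB.mixin Record isConjClosed (G : groupType) (S : {pred G}) := {
  gpred_conj : forall x y : G, x \in S -> x ^ y \in S
}.

#[short(type="normalClosed")]
HB.structure Definition NormalClosed (G : groupType) :=
  {S of GroupClosed G S & isConjClosed G S}.

Section Cosets.
Variables (G : groupType) (S : groupClosed G).

Definition coset_rel : rel G := fun x y => x^-1 * y \in S.

Lemma coset_rel_refl : reflexive coset_rel.
Proof. by move=> x; rewrite /coset_rel mulVg gpred1. Qed.

Lemma coset_rel_sym : symmetric coset_rel.
Proof. by move=> x y; rewrite /coset_rel -gpredV invgM invgK. Qed.

Lemma coset_rel_trans : transitive coset_rel.
Proof.
move=> y x z xy yz; rewrite /coset_rel.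
by rewrite -[x^-1](mulgK y) -mulgA gpredM.
Qed.

Canonical coset_equiv := EquivRel coset_rel
  coset_rel_refl coset_rel_sym coset_rel_trans.

(* Left cosets x S. *)
Definition cosets := {eq_quot coset_equiv}.

End Cosets.

HB.instance Definition _ (G : groupType) (S : groupClosed G) :=
  EqQuotient.on (cosets S).
HB.instance Definition _ (G : groupType) (S : groupClosed G) :=
  Choice.on (cosets S).

Definition quotient_group (G : groupType) (N : normalClosed G) : Type :=
  cosets N.

Section QuotientGroup.
Variables (G : groupType) (N : normalClosed G).

HB.instance Definition _ := EqQuotient.on (quotient_group N).
HB.instance Definition _ := Choice.on (quotient_group N).

Local Notation Q := (quotient_group N).

Definition quot_one : Q := \pi_Q 1.
Definition quot_mul (a b : Q) : Q := \pi_Q (repr a * repr b).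
Definition quot_inv (a : Q) : Q := \pi_Q (repr a)^-1.

Lemma quot_piE (x y : G) : (\pi_Q x = \pi_Q y) <-> (x^-1 * y \in N).
Proof. by split=> [/eqmodP//|h]; apply/eqmodP. Qed.

Lemma quot_mulE (x y : G) :
  quot_mul (\pi_Q x) (\pi_Q y) = \pi_Q (x * y).
Proof.
apply/quot_piE.
have /quot_piE hx : \pi_Q (repr (\pi_Q x)) = \pi_Q x by rewrite reprK.
have /quot_piE hy : \pi_Q (repr (\pi_Q y)) = \pi_Q y by rewrite reprK.
set x' := repr _ in hx *; set y' := repr _ in hy *.
have -> : (x' * y')^-1 * (x * y) = (x'^-1 * x) ^ y' * (y'^-1 * y).
  by rewrite /conjg invgM !mulgA mulgK.
by rewrite gpredM // gpred_conj.
Qed.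

Lemma quot_invE (x : G) : quot_inv (\pi_Q x) = \pi_Q (x^-1).
Proof.
apply/quot_piE.
have /quot_piE hx : \pi_Q (repr (\pi_Q x)) = \pi_Q x by rewrite reprK.
set x' := repr _ in hx *.
have -> : x'^-1^-1 * x^-1 = ((x'^-1 * x) ^ x'^-1)^-1.
  by rewrite /conjg !invgM !invgK !mulgA mulgK.
by rewrite gpredV gpred_conj.
Qed.

Lemma quot_mulA : associative quot_mul.
Proof.
move=> a b c; rewrite -[a]reprK -[b]reprK -[c]reprK.
rewrite (quot_mulE (repr b) (repr c)) (quot_mulE (repr a) (repr b)).
by rewrite 2!quot_mulE mulgA.
Qed.

Lemma quot_mul1 : left_id quot_one quot_mul.
Proof. by move=> a; rewrite -[a]reprK quot_mulE mul1g. Qed.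

Lemma quot_mulr1 : right_id quot_one quot_mul.
Proof. by move=> a; rewrite -[a]reprK quot_mulE mulg1. Qed.

Lemma quot_mulV : left_inverse quot_one quot_inv quot_mul.
Proof. by move=> a; rewrite -[a]reprK quot_invE quot_mulE mulVg. Qed.

Lemma quot_mulrV : right_inverse quot_one quot_inv quot_mul.
Proof. by move=> a; rewrite -[a]reprK quot_invE quot_mulE mulgV. Qed.

HB.instance Definition _ := isGroup.Build (quotient_group N)
  quot_mulA quot_mul1 quot_mulr1 quot_mulV quot_mulrV.

End QuotientGroup.

Definition group_center (G : groupType) : {pred G} :=
  fun x => `[< forall y : G, x * y = y * x >].
Arguments group_center : clear implicits.

Section Center.
Variable G : groupType.

Lemma center_mulg : mulg_closed (group_center G).
Proof.
move=> x y /asboolP cx /asboolP cy; apply/asboolP => z.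
by rewrite -mulgA cy !mulgA cx.
Qed.

Lemma center_1 : 1 \in group_center G.
Proof. by apply/asboolP => y; rewrite mul1g mulg1. Qed.

Lemma center_inv : invg_closed (group_center G).
Proof.
move=> x /asboolP cx; apply/asboolP => y.
by apply: (mulgI x); rewrite mulVKg mulgA cx mulgK.
Qed.

HB.instance Definition _ := isMulClosed.Build G (group_center G) center_mulg.
HB.instance Definition _ := isMul1Closed.Build G (group_center G) center_1.
HB.instance Definition _ := isInvClosed.Build G (group_center G) center_inv.

End Center.

(* [G, G]: the intersection of all subgroups containing the commutators. *)
Definition derived_subgroup (G : groupType) : {pred G} :=
  fun x => `[< forall S : groupClosed G,
                 (forall y z : G, [~ y, z] \in S) -> x \in S >].
Arguments derived_subgroup : clear implicits.

Section DerivedSubgroup.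
Variable G : groupType.

Lemma derived_mulg : mulg_closed (derived_subgroup G).
Proof.
move=> x y /asboolP hx /asboolP hy; apply/asboolP => S hS.
by rewrite gpredM // ?hx ?hy.
Qed.

Lemma derived_1 : 1 \in derived_subgroup G.
Proof. by apply/asboolP => S _; exact: gpred1. Qed.

Lemma derived_inv : invg_closed (derived_subgroup G).
Proof.
by move=> x /asboolP hx; apply/asboolP => S hS; rewrite gpredV hx.
Qed.

Lemma derived_conj (x y : G) :
  x \in derived_subgroup G -> x ^ y \in derived_subgroup G.
Proof.
move=> /asboolP hx; apply/asboolP => S hS.
have -> : x ^ y = x * [~ x, y] by rewrite /commg mulVKg.
by rewrite gpredM // hx.
Qed.

HB.instance Definition _ := isMulClosed.Build G (derived_subgroup G) derived_mulg.
HB.instance Definition _ := isMul1Closed.Build G (derived_subgroup G) derived_1.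
HB.instance Definition _ := isInvClosed.Build G (derived_subgroup G) derived_inv.
HB.instance Definition _ := isConjClosed.Build G (derived_subgroup G) derived_conj.

End DerivedSubgroup.

Definition abelianization (G : groupType) : groupType :=
  quotient_group (derived_subgroup G).

Definition expgz (G : groupType) (x : G) (z : int) : G :=
  match z with Posz n => x ^+ n | Negz n => x ^- n.+1 end.

Definition Z_independent (A : groupType) (r : nat) (a : 'I_r -> A) : Prop :=
  forall c : 'I_r -> int, \prod_(i < r) expgz (a i) (c i) = 1 ->
    forall i, c i = 0%R.

(* Meaningful for abelian A. *)
Definition torsion_free_rank (A : groupType) (k : nat) : Prop :=
  (exists a : 'I_k -> A, Z_independent a) /\
  (forall (r : nat) (a : 'I_r -> A), Z_independent a -> (r <= k)%N).

Definition betti1 (G : groupType) (k : nat) : Prop :=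
  torsion_free_rank (abelianization G) k.

Record automorphic_action (Q : groupType) (N : zmodType) := AutomorphicAction {
  act :> Q -> N -> N;
  act1 : forall v : N, act 1 v = v;
  actM : forall (g h : Q) (v : N), act (g * h) v = act g (act h v);
  actD : forall (g : Q) (v w : N), act g (v + w)%R = (act g v + act g w)%R
}.

(* N >| Q with (v, g) (w, h) = (v + g.w, gh). *)
Definition sdprod (Q : groupType) (N : zmodType) (phi : automorphic_action Q N)
  : Type := (N * Q)%type.

Section SemidirectProduct.
Variables (Q : groupType) (N : zmodType) (phi : automorphic_action Q N).

HB.instance Definition _ := Choice.copy (sdprod phi) (N * Q)%type.

Definition sd_one : sdprod phi := (0%R, 1).
Definition sd_mul (a b : sdprod phi) : sdprod phi :=
  ((a.1 + phi a.2 b.1)%R, a.2 * b.2).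
Definition sd_inv (a : sdprod phi) : sdprod phi :=
  ((- phi (a.2^-1)%g a.1)%R, a.2^-1).

Lemma act_0 (g : Q) : phi g 0%R = 0%R.
Proof. by apply: (addrI (phi g 0%R)); rewrite -actD !addr0. Qed.

Lemma act_N (g : Q) (v : N) : phi g (- v)%R = (- phi g v)%R.
Proof. by apply: (addrI (phi g v)); rewrite -actD !subrr act_0. Qed.

Lemma sd_mulA : associative sd_mul.
Proof.
by move=> [a1 a2] [b1 b2] [c1 c2]; rewrite /sd_mul /= mulgA actD actM addrA.
Qed.

Lemma sd_mul1 : left_id sd_one sd_mul.
Proof. by move=> [a1 a2]; rewrite /sd_mul /= act1 add0r mul1g. Qed.

Lemma sd_mulr1 : right_id sd_one sd_mul.
Proof. by move=> [a1 a2]; rewrite /sd_mul /= act_0 addr0 mulg1. Qed.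

Lemma sd_mulV : left_inverse sd_one sd_inv sd_mul.
Proof. by move=> [a1 a2]; rewrite /sd_mul /sd_inv /= addNr mulVg. Qed.

Lemma sd_mulrV : right_inverse sd_one sd_inv sd_mul.
Proof.
by move=> [a1 a2]; rewrite /sd_mul /sd_inv /= act_N -actM mulgV act1 subrr.
Qed.

HB.instance Definition _ := isGroup.Build (sdprod phi)
  sd_mulA sd_mul1 sd_mulr1 sd_mulV sd_mulrV.

End SemidirectProduct.

(* Group presentations.  A letter (x, true) stands for the generator x and
   (x, false) for its inverse. *)
Definition word (X : choiceType) := seq (X * bool).

Inductive pres_eq (X : choiceType) (rels : seq (word X))
  : word X -> word X -> Prop :=
| pres_refl u : pres_eq rels u u
| pres_sym u v : pres_eq rels u v -> pres_eq rels v u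
| pres_trans u v w : pres_eq rels u v -> pres_eq rels v w -> pres_eq rels u w
| pres_cat u u' v v' : pres_eq rels u u' -> pres_eq rels v v' ->
    pres_eq rels (u ++ v) (u' ++ v')
| pres_cancel x b : pres_eq rels [:: (x, b); (x, ~~ b)] [::]
| pres_rel r : r \in rels -> pres_eq rels r [::].

Section Presentation.
Variables (X : choiceType) (rels : seq (word X)).

Definition pres_rel_b : rel (word X) := fun u v => `[< pres_eq rels u v >].

Lemma pres_rel_refl : reflexive pres_rel_b.
Proof. by move=> u; apply/asboolP; exact: pres_refl. Qed.

Lemma pres_rel_sym : symmetric pres_rel_b.
Proof. by move=> u v; apply/asboolP/asboolP; exact: pres_sym. Qed.

Lemma pres_rel_trans : transitive pres_rel_b.
Proof.
by move=> v u w /asboolP uv /asboolP vw; apply/asboolP; exact: pres_trans vw.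
Qed.

Canonical pres_equiv := EquivRel pres_rel_b
  pres_rel_refl pres_rel_sym pres_rel_trans.

Definition presented := {eq_quot pres_equiv}.

HB.instance Definition _ := EqQuotient.on presented.
HB.instance Definition _ := Choice.on presented.

Definition word_inv (u : word X) : word X :=
  [seq (l.1, ~~ l.2) | l <- rev u].

Definition pres_one : presented := \pi_presented [::].
Definition pres_mul (a b : presented) : presented :=
  \pi_presented (repr a ++ repr b).
Definition pres_inv (a : presented) : presented :=
  \pi_presented (word_inv (repr a)).

Lemma pres_piE (u v : word X) :
  (\pi_presented u = \pi_presented v) <-> pres_eq rels u v.
Proof. by split=> [/eqmodP/asboolP//|h]; apply/eqmodP/asboolP. Qed.

Lemma pres_mulE (u v : word X) :
  pres_mul (\pi_presented u) (\pi_presented v) = \pi_presented (u ++ v).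
Proof. by apply/pres_piE; apply: pres_cat; apply/pres_piE; rewrite reprK. Qed.

Lemma word_invK : involutive word_inv.
Proof.
move=> u; rewrite /word_inv -map_rev revK -map_comp -[RHS]map_id.
by apply: eq_map => -[x b] /=; rewrite negbK.
Qed.

Lemma pres_word_catV (u : word X) : pres_eq rels (u ++ word_inv u) [::].
Proof.
elim: u => [|[x b] u IHu]; first exact: pres_refl.
rewrite /word_inv rev_cons map_rcons -/(word_inv u) -cats1 catA /=.
rewrite -cat1s; apply: pres_trans (pres_cancel _ x b).
rewrite -[[:: _; _]]/([:: (x, b)] ++ ([::] ++ [:: (x, ~~ b)])).
by do 2?[apply: pres_cat; try exact: pres_refl].
Qed.

Lemma pres_word_Vcat (u : word X) : pres_eq rels (word_inv u ++ u) [::].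
Proof. by have := pres_word_catV (word_inv u); rewrite word_invK. Qed.

Lemma pres_mulA : associative pres_mul.
Proof.
move=> a b c; rewrite -[a]reprK -[b]reprK -[c]reprK.
rewrite (pres_mulE (repr b) (repr c)) (pres_mulE (repr a) (repr b)).
by rewrite 2!pres_mulE catA.
Qed.

Lemma pres_mul1 : left_id pres_one pres_mul.
Proof. by move=> a; rewrite -[a]reprK pres_mulE. Qed.

Lemma pres_mulr1 : right_id pres_one pres_mul.
Proof. by move=> a; rewrite -[a]reprK pres_mulE cats0. Qed.

Lemma pres_mulV : left_inverse pres_one pres_inv pres_mul.
Proof.
move=> a; rewrite -[X in pres_mul _ X]reprK pres_mulE.
by apply/pres_piE; exact: pres_word_Vcat.
Qed.

Lemma pres_mulrV : right_inverse pres_one pres_inv pres_mul.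
Proof.
move=> a; rewrite -[X in pres_mul X _]reprK pres_mulE.
by apply/pres_piE; exact: pres_word_catV.
Qed.

HB.instance Definition _ := isGroup.Build presented
  pres_mulA pres_mul1 pres_mulr1 pres_mulV pres_mulrV.

End Presentation.

(* The generators x and y are indexed by false and true; the relators are
   x^-1 y^2 x y^2 and y^-1 x^2 y x^2. *)
Definition DeltaP_relators : seq (word bool) :=
  let x := (false, true) in let x' := (false, false) in
  let y := (true, true) in let y' := (true, false) in
  [:: [:: x'; y; y; x; y; y]; [:: y'; x; x; y; x; x]].

Definition DeltaP : groupType := presented DeltaP_relators.

Section Orthogonal.
Local Open Scope ring_scope.
Variables (R : realType) (n : nat).

Definition orthogonal_matrix : pred 'M[R]_n := fun A => A^T *m A == 1%:M.

Definition orthogonal_group : Type := {A : 'M[R]_n | orthogonal_matrix A}.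

HB.instance Definition _ := SubType.on orthogonal_group.
HB.instance Definition _ := Choice.on orthogonal_group.
HB.instance Definition _ := Topological.copy orthogonal_group
  (initial_topology (val : orthogonal_group -> 'M[R]_n)).

Lemma ortho_one_subproof : orthogonal_matrix 1%:M.
Proof. by rewrite /orthogonal_matrix trmx1 mul1mx. Qed.

Lemma ortho_mul_subproof (A B : orthogonal_group) :
  orthogonal_matrix (val A *m val B).
Proof.
case: A B => [A /= /eqP oA] [B /= oB].
by rewrite /orthogonal_matrix trmx_mul -mulmxA [A^T *m _]mulmxA oA mul1mx.
Qed.

Lemma ortho_inv_subproof (A : orthogonal_group) :
  orthogonal_matrix (val A)^T.
Proof.
by case: A => A /= /eqP oA; rewrite /orthogonal_matrix trmxK (mulmx1C oA).
Qed.

Definition ortho_one : orthogonal_group :=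
  exist orthogonal_matrix _ ortho_one_subproof.
Definition ortho_mul (A B : orthogonal_group) : orthogonal_group :=
  exist orthogonal_matrix _ (ortho_mul_subproof A B).
Definition ortho_inv (A : orthogonal_group) : orthogonal_group :=
  exist orthogonal_matrix _ (ortho_inv_subproof A).

Lemma ortho_mulA : associative ortho_mul.
Proof. by move=> A B C; apply/val_inj; rewrite /= mulmxA. Qed.

Lemma ortho_mul1 : left_id ortho_one ortho_mul.
Proof. by move=> A; apply/val_inj; rewrite /= mul1mx. Qed.

Lemma ortho_mulr1 : right_id ortho_one ortho_mul.
Proof. by move=> A; apply/val_inj; rewrite /= mulmx1. Qed.

Lemma ortho_mulV : left_inverse ortho_one ortho_inv ortho_mul.
Proof. by move=> A; apply/val_inj; rewrite /=; exact/eqP/(valP A). Qed.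

Lemma ortho_mulrV : right_inverse ortho_one ortho_inv ortho_mul.
Proof.
by move=> A; apply/val_inj; rewrite /=; apply: mulmx1C; exact/eqP/(valP A).
Qed.

HB.instance Definition _ := isGroup.Build orthogonal_group
  ortho_mulA ortho_mul1 ortho_mulr1 ortho_mulV ortho_mulrV.

Lemma ortho_act1 (v : 'cV[R]_n) : val (1%g : orthogonal_group) *m v = v.
Proof. exact: mul1mx. Qed.

Lemma ortho_actM (A B : orthogonal_group) (v : 'cV[R]_n) :
  val (A * B)%g *m v = val A *m (val B *m v).
Proof. by rewrite mulmxA. Qed.

Definition ortho_act : automorphic_action orthogonal_group 'cV[R]_n :=
  AutomorphicAction ortho_act1 ortho_actM
    (fun A v w => mulmxDr (val A) v w).

(* Isom(E^n): the pair (v, A) is the map x |-> A x + v. *)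
Definition euclidean_isom : Type := sdprod ortho_act.

HB.instance Definition _ := Group.on euclidean_isom.
HB.instance Definition _ :=
  Topological.copy euclidean_isom ('cV[R]_n * orthogonal_group)%type.

Definition translation (v : 'cV[R]_n) : euclidean_isom := (v, 1%g).

End Orthogonal.

Section Crystallographic.
Variables (R : realType) (n : nat).
Implicit Type Gamma : groupClosed (euclidean_isom R n).

Definition discrete_subgroup Gamma : Prop :=
  (isolated [set` Gamma] = [set` Gamma])%classic.

Definition cocompact Gamma : Prop :=
  compact [set: quotient_topology (cosets Gamma)]%classic.

Definition crystallographic Gamma : Prop :=
  discrete_subgroup Gamma /\ cocompact Gamma.

Definition bieberbach Gamma : Prop :=
  crystallographic Gamma /\ torsion_free (subgroup Gamma).

(* The intersection of Gamma with the translations, inside Gamma. *)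
Definition lattice Gamma : {pred subgroup Gamma} :=
  fun g => (val g).2 == 1.
Arguments lattice : clear implicits.

Section Lattice.
Variable Gamma : groupClosed (euclidean_isom R n).

Lemma lattice_mulg : mulg_closed (lattice Gamma).
Proof.
move=> x y /eqP hx /eqP hy; apply/eqP.
by rewrite -[LHS]/((val x).2 * (val y).2) hx hy mul1g.
Qed.

Lemma lattice_1 : 1 \in lattice Gamma.
Proof. exact/eqP. Qed.

Lemma lattice_inv : invg_closed (lattice Gamma).
Proof.
by move=> x /eqP hx; apply/eqP; rewrite -[LHS]/((val x).2^-1) hx invg1.
Qed.

Lemma lattice_conj (x y : subgroup Gamma) :
  x \in lattice Gamma -> x ^ y \in lattice Gamma.
Proof.
move=> /eqP hx; apply/eqP; rewrite -[LHS]/((val x).2 ^ (val y).2) hx.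
by rewrite /conjg mul1g mulVg.
Qed.

HB.instance Definition _ :=
  isMulClosed.Build (subgroup Gamma) (lattice Gamma) lattice_mulg.
HB.instance Definition _ :=
  isMul1Closed.Build (subgroup Gamma) (lattice Gamma) lattice_1.
HB.instance Definition _ :=
  isInvClosed.Build (subgroup Gamma) (lattice Gamma) lattice_inv.
HB.instance Definition _ :=
  isConjClosed.Build (subgroup Gamma) (lattice Gamma) lattice_conj.

End Lattice.

Definition holonomy_group Gamma : groupType := quotient_group (lattice Gamma).

Definition lattice_basis Gamma (e : 'I_n -> 'cV[R]_n) : Prop :=
  (forall v : 'cV[R]_n, translation v \in Gamma <->
     exists c : 'I_n -> int, v = (\sum_(i < n) e i *~ c i)%R) /\
  (forall c : 'I_n -> int, (\sum_(i < n) e i *~ c i = 0)%R ->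
     forall i, c i = 0%R).

(* The holonomy group acts on the lattice through conjugation by
   representatives in Gamma. *)
Definition diagonal_holonomy Gamma : Prop :=
  exists2 e : 'I_n -> 'cV[R]_n, lattice_basis Gamma e &
    forall (g : euclidean_isom R n) (i : 'I_n), g \in Gamma ->
      g * translation (e i) * g^-1 = translation (e i) \/
      g * translation (e i) * g^-1 = translation (- e i)%R.

End Crystallographic.
Arguments lattice {R n} Gamma _.

Definition diagonal_type (R : realType) (n : nat)
    (Gamma : groupClosed (euclidean_isom R n)) : Prop :=
  exists (m : nat) (Gamma' : groupClosed (euclidean_isom R m)),
    [/\ crystallographic Gamma',
        isomorphic (subgroup Gamma) (subgroup Gamma') &
        diagonal_holonomy Gamma'].

(* C_2 is the additive group Z/2. *)
Definition C2xC2 : groupType := ('Z_2 * 'Z_2)%type.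

(* Main.v *)
(* In a Z-basis of the lattice that diagonalises the holonomy, the group acts on
   each coordinate through one of the four characters of C_2 x C_2, and the
   class of the extension is recorded, coordinate by coordinate, by the parity
   of twice the translation part.

   If some coordinate with trivial character has odd parity, it defines a map
   onto Z whose kernel has holonomy of order at most two; iterating once more
   gives a lexicographic right order, and an ordered group is diffuse.

   Otherwise torsion-freeness produces, for each of the three nontrivial
   characters, a special coordinate of odd parity.  These three coordinates map
   the group onto the Hantzsche-Wendt group.  Subtracting the special coordinate
   from the other coordinates of odd parity with the same character makes them
   all even, so the map splits; the coordinates with trivial character form the
   center, and their number is the first Betti number.

   The Hantzsche-Wendt group itself has a six-element subset without extremal
   points. *)
Require Import Defs.
From mathcomp Require Import all_boot all_order all_algebra.
From mathcomp Require Import all_classical all_reals topology normedtype.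
From HB Require Import structures.
From mathcomp Require Import finmap zify ring lra.
Import Order.TTheory GRing.Theory Num.Theory.
Import numFieldNormedType.Exports.

Set Implicit Arguments.
Unset Strict Implicit.
Unset Printing Implicit Defensive.
Local Open Scope quotient_scope.
Local Open Scope group_scope.

(** * Morphisms, extremal points and integer powers *)

(** Diagonal type is given by an abstract isomorphism onto a group [Gamma'] in a possibly different
    dimension, whereas the holonomy hypothesis is about [Gamma]. The two translation lattices are
    therefore matched algebraically. Squares in [Gamma] are translations and commute with its
    lattice; conversely, an element that commutes with the lattice of [Gamma] is a translation,
    because cocompactness makes this lattice span R^n. Discreteness turns independence over Z into
    independence over R, and the dimensions agree.

    After that everything is integer arithmetic. A good choice of origin leaves each coordinate with
    nontrivial character a single free bit of parity, so two odd coordinates with the same character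
    have the same parity on the whole group. This is why their difference is even, and why the map
    onto the Hantzsche-Wendt group has a section. For the Betti number, fourth powers are the right
    exponent: squares have even entries, and commutators with lattice elements reach exactly the
    multiples of 4 in the nontrivial coordinates. *)

Section Morphisms.
Variables (G H : groupType) (f : G -> H).
Hypothesis fM : {morph f : x y / x * y}.

Lemma morph_1 : f 1 = 1.
Proof. by apply: (mulgI (f 1)); rewrite -fM !mulg1. Qed.

Lemma morph_V : {morph f : x / x^-1}.
Proof. by move=> x; apply: (mulgI (f x)); rewrite -fM !mulgV morph_1. Qed.

Lemma morph_X n : {morph f : x / x ^+ n}.
Proof. by move=> x; elim: n => [|n IHn]; rewrite ?morph_1 // !expgS fM IHn. Qed.

Lemma morph_expgz (z : int) (x : G) : f (expgz x z) = expgz (f x) z.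
Proof. by case: z => n; rewrite /= ?morph_V morph_X. Qed.

Lemma morph_inj : (forall x, f x = 1 -> x = 1) -> injective f.
Proof.
move=> f1 x y fxy; apply: divg1_eq; apply: f1.
by rewrite fM morph_V fxy mulgV.
Qed.

Lemma isomorphic_of_bij : injective f -> (forall y, exists x, f x = y) ->
  isomorphic G H.
Proof.
move=> finj fsurj.
pose F : {multiplicative G -> H} := HB.pack f (isMultiplicative.Build G H f fM).
exists F.
have [g gP] := choice fsurj.
by exists g => x; [apply: finj; rewrite gP | exact: gP].
Qed.

(** Diffuseness passes to subgroups: each [g] in [G] yields the test element [f g], so an extremal
    point of the image of [A] comes from an extremal point of [A]. *)
Lemma nondiffuse_of_inj : injective f -> ~ diffuse G -> ~ diffuse H.
Proof.
move=> finj nG dH; apply: nG => A cA.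
have [|a [b [ab ea eb]]] := dH (f @` A)%fset.
  by rewrite card_imfset.
have ext c : extremal (f @` A)%fset c -> exists2 x, c = f x & extremal A x.
  case=> /imfsetP [/= x xA ->] ec; exists x => //; split=> // g g1.
  have /ec : f g != 1.
    by apply: contra_neq g1 => fg1; apply: finj; rewrite fg1 morph_1.
  rewrite -morph_V -!fM.
  by case/orP=> nA; [apply/orP; left | apply/orP; right];
    apply: contra nA => hA; exact: in_imfset.
have [x ax ex] := ext _ ea; have [y by_ ey] := ext _ eb.
by exists x, y; split=> //; apply: contra_neq ab => xy; rewrite ax by_ xy.
Qed.

End Morphisms.

Lemma isomorphic_sym (G H : groupType) : isomorphic G H -> isomorphic H G.
Proof.
case=> f [g fK gK]; apply: (@isomorphic_of_bij _ _ g).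
- by move=> x y; apply: (can_inj fK); rewrite gK gmulfM !gK.
- exact: can_inj gK.
- by move=> y; exists (f y).
Qed.

(* A total order given by its positive cone is compared through y x^-1, so
   that it is invariant under right translations; the maximum and the minimum
   of a finite set are then extremal. *)
Lemma diffuse_of_cone (G : groupType) (pos : pred G) :
  (forall x y, pos x -> pos y -> pos (x * y)) ->
  ~~ pos 1 -> (forall x, x != 1 -> pos x || pos x^-1) -> diffuse G.
Proof.
move=> posM pos1 pos_tot A cA.
(* An arbitrary cone [P], so that [pos] gives the maximum and the opposite cone the minimum. *)
have extreme (P : pred G) : (forall x y, P x -> P y -> P (x * y)) ->
    ~~ P 1 -> (forall x, x != 1 -> P x || P x^-1) ->
    exists2 a, extremal A a & forall c, c \in A -> c != a -> P (a * c^-1).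
  move=> PM P1 Ptot.
  suff [a aA amax] : exists2 a, a \in A & forall c, c \in A -> c != a -> P (a * c^-1).
    exists a => //; split=> // g g1.
    have bad h : h != 1 -> P h -> h * a \notin A.
      move=> h1 Ph; apply/negP => /amax; rewrite -[X in _ != X]mul1g.
      rewrite (inj_eq (@mulIg _ a)) => /(_ h1).
      rewrite invgM mulVKg => PhV.
      by move: P1; rewrite -(mulgV h) PM.
    have := Ptot g g1; case/orP=> Pg; [apply/orP; left | apply/orP; right]; apply: bad => //.
    by rewrite invg_eq1.
  have [x0 x0A] : exists x, x \in A.
    by apply/fset0Pn; rewrite -cardfs_gt0; apply: leq_trans cA.
  have : forall s : seq G, s != [::] -> exists2 a, a \in s & forall c, c \in s -> c != a -> P (a * c^-1).
    elim=> [//|x s IHs] _; have [->|sN] := eqVneq s [::].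
      by exists x; rewrite ?mem_head // => c; rewrite inE => /eqP->; rewrite eqxx.
    have [a as_ ha] := IHs sN.
    have [xa|xa] := eqVneq x a.
      exists a; first by rewrite inE as_ orbT.
      by move=> c; rewrite inE => /predU1P[->|/ha//]; rewrite xa eqxx.
    have : a * x^-1 != 1 by rewrite divg_eq1 eq_sym.
    case/Ptot/orP=> Pax.
      exists a; first by rewrite inE as_ orbT.
      by move=> c; rewrite inE => /predU1P[->//|/ha].
    move: Pax; rewrite invgF => Pxa.
    exists x; rewrite ?mem_head // => c; rewrite inE => /predU1P[->|cs cx].
      by rewrite eqxx.
    have [->//|ca] := eqVneq c a.
    by rewrite -(divgKA a); apply: PM => //; apply: ha.
  move=> /(_ (enum_fset A)) [|a]; last by exists a.
  by apply: contraTneq x0A => A0; rewrite -[x0 \in A]/(x0 \in enum_fset A) A0.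
have [a ea amax] := extreme pos posM pos1 pos_tot.
have [|||b eb bmin] := extreme (fun x => pos x^-1).
- by move=> x y px py; rewrite invgM posM.
- by rewrite invg1.
- by move=> x x1; rewrite invgK orbC pos_tot.
exists a, b; split=> //; apply/eqP => ab.
have [c kA ca] : exists2 c, c \in A & c != a.
  apply: contrapT => nc; move: cA.
  suff -> : A = [fset a]%fset by rewrite cardfs1.
  apply/fsetP => c; rewrite inE; apply/idP/eqP => [kA|->]; last by case: ea.
  by apply/eqP; apply: contrapT => /negP ca; apply: nc; exists c.
have := amax c kA ca; have := bmin c kA; rewrite -ab => /(_ ca).
by move=> pV p; move: pos1; rewrite -(mulgV (a / c)) posM.
Qed.

Section IntPowers.
Variable G : groupType.
Implicit Types (x y : G) (z : int).

Lemma expgz0 x : expgz x 0%R = 1. Proof. by []. Qed.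

Lemma expgzS x z : expgz x (z + 1)%R = expgz x z * x.
Proof.
case: z => n.
  have -> : (Posz n + 1)%R = Posz n.+1 by lia.
  exact: expgSr.
case: n => [|n]; first by rewrite /= mulVg.
have -> : (Negz n.+1 + 1)%R = Negz n by lia.
by rewrite /= [x ^+ n.+2]expgS invgM mulgVK.
Qed.

Lemma expgzP x z : expgz x (z - 1)%R = expgz x z * x^-1.
Proof. by rewrite -[in RHS](subrK 1%R z) expgzS mulgK. Qed.

Lemma expgz_ind (P : int -> Prop) : P 0%R ->
  (forall z, P z -> P (z + 1)%R) -> (forall z, P z -> P (z - 1)%R) ->
  forall z, P z.
Proof.
move=> P0 PS PP; elim/int_ind => // n IHn.
  by rewrite -addn1 PoszD; apply: PS.
by rewrite -addn1 PoszD opprD; apply: PP.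
Qed.

Lemma expgzD x z t : expgz x (z + t)%R = expgz x z * expgz x t.
Proof.
elim/expgz_ind: t => [|t IHt|t IHt]; first by rewrite addr0 mulg1.
  by rewrite addrA !expgzS IHt mulgA.
by rewrite addrA !expgzP IHt mulgA.
Qed.

Lemma expgzN x z : expgz x (- z)%R = (expgz x z)^-1.
Proof.
by apply: (mulgI (expgz x z)); rewrite mulgV -expgzD subrr.
Qed.

Lemma expgz_commute x y z : commute x y -> commute x (expgz y z).
Proof.
by move=> xy; case: z => n; [exact: commuteX | apply/commuteV/commuteX].
Qed.

Lemma expgz_flip x y z : x * y = y^-1 * x -> x * expgz y z = expgz y (- z)%R * x.
Proof.
move=> xy.
have xyV : x * y^-1 = y * x.
  by apply: (mulgI y^-1); rewrite mulKg mulgA -xy mulgK.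
elim/expgz_ind: z => [|z IHz|z IHz]; first by rewrite oppr0 !expgz0 mulg1 mul1g.
  by rewrite expgzS mulgA IHz -mulgA xy mulgA opprD expgzP.
by rewrite expgzP mulgA IHz -mulgA xyV mulgA opprB addrC expgzS.
Qed.

End IntPowers.

(** * Morphisms out of a presented group *)

Section PresentedMorphism.
Variables (X : choiceType) (rels : seq (word X)) (H : groupType) (f : X -> H).

Definition word_eval (w : word X) : H :=
  \prod_(l <- w) (if l.2 then f l.1 else (f l.1)^-1).

Hypothesis relP : forall r, r \in rels -> word_eval r = 1.

Lemma word_eval_cat u v : word_eval (u ++ v) = word_eval u * word_eval v.
Proof. exact: big_cat. Qed.

Lemma word_eval_pres u v : pres_eq rels u v -> word_eval u = word_eval v.
Proof.
elim=> {u v} //.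
- by move=> u v w _ -> _ ->.
- by move=> u u' v v' _ IHu _ IHv; rewrite !word_eval_cat IHu IHv.
- move=> x b; rewrite /word_eval !big_cons big_nil mulg1.
  by case: b; rewrite /= ?mulgV ?mulVg.
- by move=> r rr; rewrite relP // /word_eval big_nil.
Qed.

Definition pres_lift (d : presented rels) : H := word_eval (repr d).

Lemma pres_lift_pi w : pres_lift (\pi_(presented rels) w) = word_eval w.
Proof. by apply: word_eval_pres; apply/pres_piE; rewrite reprK. Qed.

Lemma pres_liftM : {morph pres_lift : x y / x * y}.
Proof.
move=> x y; rewrite -[x]reprK -[y]reprK.
have -> : \pi_(presented rels) (repr x) * \pi_(presented rels) (repr y)
    = \pi_(presented rels) (repr x ++ repr y) by exact: pres_mulE.
by rewrite !pres_lift_pi word_eval_cat.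
Qed.

End PresentedMorphism.

Lemma presented_ind (X : choiceType) (rels : seq (word X))
    (P : presented rels -> Prop) :
  P 1 -> (forall x b d, P d -> P (\pi_(presented rels) [:: (x, b)] * d)) ->
  forall d, P d.
Proof.
move=> P1 PM d; rewrite -[d]reprK; elim: (repr d) => [|[x b] w IHw].
  exact: P1.
have -> : \pi_(presented rels) ((x, b) :: w)
    = \pi_(presented rels) [:: (x, b)] * \pi_(presented rels) w.
  by apply/esym; exact: pres_mulE.
exact: PM.
Qed.

(** * The Promislow group *)

Section PromislowNormalForm.
Variables (G : groupType) (x y : G).
Hypothesis xY : x * (y * y) = (y * y)^-1 * x.
Hypothesis yX : y * (x * x) = (x * x)^-1 * y.

Local Notation X := (x * x).
Local Notation Y := (y * y).
Local Notation Z := ((x * y) * (x * y)).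

Lemma flipV (u v : G) : u * v = v^-1 * u -> u * v^-1 = v * u.
Proof. by move=> uv; apply: (mulgI v^-1); rewrite mulKg mulgA -uv mulgK. Qed.

Lemma promislow_XY : commute X Y.
Proof.
apply/commute_sym; rewrite /commute -mulgA yX mulgA (flipV yX).
by rewrite -mulgA.
Qed.

Lemma commuteVl (u v : G) : commute u v -> commute u^-1 v.
Proof. by move=> /commute_sym /commuteV /commute_sym. Qed.

(** The one reordering rule for normal forms: it moves [x] to the left of [y] at the price of powers
    of [X], [Y] and [Z]. *)
Lemma promislow_yx : y * x = Z^-1 * (X^-1 * (Y * (x * y))).
Proof.
apply: (mulgI Z); rewrite mulVKg.
have -> : Z * (y * x) = x * y * (x * Y) * x by rewrite !mulgA.
rewrite xY.
have -> : x * y * (Y^-1 * x) * x = x * (y * Y^-1) * X by rewrite !mulgA.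
have -> : y * Y^-1 = Y^-1 * y by rewrite invgM mulgA mulgV mulgVK mul1g.
have -> : x * (Y^-1 * y) * X = (x * Y^-1) * (y * X) by rewrite !mulgA.
rewrite (flipV xY) yX.
have -> : Y * x * (X^-1 * y) = Y * (x * X^-1) * y by rewrite !mulgA.
have -> : x * X^-1 = X^-1 * x by rewrite invgM mulgA mulgV mulgVK mul1g.
by rewrite [X^-1 * (Y * _)]mulgA (commuteVl promislow_XY) !mulgA.
Qed.

(** Since conjugation by [y] turns [(x y)^2] into [(y x)^2], this identity is what makes both [x]
    and [y] invert [Z]. *)
Lemma promislow_yxyx : (y * x) * (y * x) = Z^-1.
Proof.
rewrite {1}promislow_yx -[RHS]mulg1 -!mulgA; congr (_ * _).
apply: (mulgI X); rewrite mulVKg mulg1.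
have -> : y * (y * (x * (y * (y * x)))) = Y * (x * Y) * x by rewrite !mulgA.
by rewrite xY mulgA mulgV mul1g.
Qed.

Lemma promislow_yZ : y * Z = Z^-1 * y.
Proof. by rewrite -promislow_yxyx !mulgA. Qed.

Lemma promislow_xZ : x * Z = Z^-1 * x.
Proof.
apply: (mulgI Z); rewrite mulVKg.
have -> : Z * (x * Z) = x * ((y * x) * (y * x)) * Z by rewrite !mulgA.
by rewrite promislow_yxyx mulgVK.
Qed.

Lemma commute_flip2 (u v : G) : u * v = v^-1 * u -> commute (u * u) v.
Proof. by move=> uv; rewrite /commute -mulgA uv mulgA (flipV uv) mulgA. Qed.

Definition promislow_T (i j l : int) := expgz X i * expgz Y j * expgz Z l.

Lemma promislow_TM i j l i' j' l' :
  promislow_T i j l * promislow_T i' j' l'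
  = promislow_T (i + i')%R (j + j')%R (l + l')%R.
Proof.
have cZX s t : commute (expgz Z s) (expgz X t).
  by apply/expgz_commute/commute_sym/expgz_commute/commute_flip2/promislow_xZ.
have cZY s t : commute (expgz Z s) (expgz Y t).
  by apply/expgz_commute/commute_sym/expgz_commute/commute_flip2/promislow_yZ.
have cYX s t : commute (expgz Y s) (expgz X t).
  by apply/expgz_commute/commute_sym/expgz_commute/promislow_XY.
rewrite /promislow_T !expgzD.
move: (cZX l i') (cZY l j') (cYX j i').
move: (expgz X i) (expgz Y j) (expgz Z l) (expgz X i') (expgz Y j') (expgz Z l').
move=> a b c a' b' c' ca cb ba.
rewrite !mulgA -[a * b * c * a']mulgA ca mulgA -[a * b * a']mulgA ba mulgA.
by rewrite -[a * a' * b * c * b']mulgA cb !mulgA.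
Qed.

Lemma promislow_xT i j l :
  x * promislow_T i j l = promislow_T i (- j)%R (- l)%R * x.
Proof.
have : x * expgz X i = expgz X i * x by apply/expgz_commute/commuteM.
have := expgz_flip l promislow_xZ; have := expgz_flip j xY; rewrite /promislow_T.
move: (expgz X i) (expgz Y j) (expgz Z l) (expgz Y (- j)%R) (expgz Z (- l)%R).
move=> a b c b' c' xb xc xa.
by rewrite !mulgA xa -[a * x * b]mulgA xb !mulgA -[_ * x * c]mulgA xc !mulgA.
Qed.

Lemma promislow_yT i j l :
  y * promislow_T i j l = promislow_T (- i)%R j (- l)%R * y.
Proof.
have : y * expgz Y j = expgz Y j * y by apply/expgz_commute/commuteM.
have := expgz_flip l promislow_yZ; have := expgz_flip i yX; rewrite /promislow_T.
move: (expgz X i) (expgz Y j) (expgz Z l) (expgz X (- i)%R) (expgz Z (- l)%R).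
move=> a b c a' c' ya yc yb.
by rewrite !mulgA ya -[a' * y * b]mulgA yb !mulgA -[_ * y * c]mulgA yc !mulgA.
Qed.

Definition promislow_nf (i j l : int) (q1 q2 : bool) :=
  promislow_T i j l * (x ^+ q1 * y ^+ q2).

(** Existence suffices here: uniqueness is read off from the values of normal forms under
    [hw_rep]. *)
Definition has_nf (g : G) := exists i j l q1 q2, g = promislow_nf i j l q1 q2.

Lemma has_nf_T i j l g : has_nf g -> has_nf (promislow_T i j l * g).
Proof.
case=> i' [j' [l' [q1 [q2 ->]]]]; rewrite /promislow_nf mulgA promislow_TM.
by do 5!eexists.
Qed.

Lemma has_nf_q (q1 q2 : bool) : has_nf (x ^+ q1 * y ^+ q2).
Proof.
exists 0%R, 0%R, 0%R, q1, q2.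
by rewrite /promislow_nf /promislow_T !expgz0 !mul1g.
Qed.

Lemma promislow_TX : promislow_T 1 0 0 = X.
Proof. by rewrite /promislow_T !mulg1. Qed.
Lemma promislow_TXV : promislow_T (-1)%R 0 0 = X^-1.
Proof. by rewrite /promislow_T !mulg1. Qed.
Lemma promislow_TY : promislow_T 0 1 0 = Y.
Proof. by rewrite /promislow_T mulg1 mul1g. Qed.
Lemma promislow_TYV : promislow_T 0 (-1)%R 0 = Y^-1.
Proof. by rewrite /promislow_T mulg1 mul1g. Qed.
Lemma promislow_TZV : promislow_T 0 0 (-1)%R = Z^-1.
Proof. by rewrite /promislow_T !mul1g. Qed.

Lemma has_nf_x g : has_nf g -> has_nf (x * g).
Proof.
case=> i [j [l [q1 [q2 ->]]]]; rewrite /promislow_nf mulgA promislow_xT -mulgA.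
apply: has_nf_T; case: q1 => /=; last by rewrite mul1g; exact: (has_nf_q true).
rewrite mulgA -promislow_TX; apply: has_nf_T.
by rewrite -[y ^+ q2]mul1g; exact: (has_nf_q false).
Qed.

Lemma has_nf_y g : has_nf g -> has_nf (y * g).
Proof.
case=> i [j [l [q1 [q2 ->]]]]; rewrite /promislow_nf mulgA promislow_yT -mulgA.
apply: has_nf_T; case: q1; rewrite /= ?expg1 ?expg0.
  rewrite mulgA promislow_yx.
  have -> (t : G) : Z^-1 * (X^-1 * (Y * (x * y))) * t
      = Z^-1 * (X^-1 * (Y * (x * (y * t)))) by rewrite !mulgA.
  rewrite -promislow_TZV; apply: has_nf_T.
  rewrite -promislow_TXV; apply: has_nf_T.
  rewrite -promislow_TY; apply: has_nf_T.
  case: q2 => /=; last by have := has_nf_q true true; rewrite /= mulg1.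
  rewrite expg1 xY -promislow_TYV; apply: has_nf_T.
  by have := has_nf_q true false; rewrite /= mulg1.
rewrite mul1g; case: q2 => /=; last first.
  by have := has_nf_q false true; rewrite /= mulg1 mul1g.
rewrite expg1 -[Y]mulg1 -promislow_TY; apply: has_nf_T.
by have := has_nf_q false false; rewrite /= mulg1.
Qed.

Lemma has_nf_xV g : has_nf g -> has_nf (x^-1 * g).
Proof.
have -> : x^-1 = X^-1 * x by rewrite invgM mulgVK.
by move=> h; rewrite -mulgA -promislow_TXV; apply/has_nf_T/has_nf_x.
Qed.

Lemma has_nf_yV g : has_nf g -> has_nf (y^-1 * g).
Proof.
have -> : y^-1 = Y^-1 * y by rewrite invgM mulgVK.
by move=> h; rewrite -mulgA -promislow_TYV; apply/has_nf_T/has_nf_y.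
Qed.

End PromislowNormalForm.

(** Both relators have this shape; the nesting to the right is the one that [DeltaP_cons] produces
    from a word. *)
Lemma relator_flip (G : groupType) (x y : G) :
  x^-1 * (y * (y * (x * (y * y)))) = 1 -> x * (y * y) = (y * y)^-1 * x.
Proof.
move=> /mulg1_eq; rewrite invgK => {2}->.
by rewrite !mulgA invgM mulgVK mulVg mul1g.
Qed.

Definition Dx : DeltaP := \pi_(presented DeltaP_relators) [:: (false, true)].
Definition Dy : DeltaP := \pi_(presented DeltaP_relators) [:: (true, true)].

Lemma DeltaP_cons l l' (w : word bool) :
  (\pi_(presented DeltaP_relators) [:: l, l' & w] : DeltaP)
  = (\pi_(presented DeltaP_relators) [:: l] : DeltaP)
    * \pi_(presented DeltaP_relators) (l' :: w).
Proof. by apply/esym; exact: (pres_mulE _ [:: l]). Qed.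

Lemma DeltaP_invE b : (\pi_(presented DeltaP_relators) [:: (b, false)] : DeltaP)
  = (\pi_(presented DeltaP_relators) [:: (b, true)] : DeltaP)^-1.
Proof.
apply: (mulgI (\pi_(presented DeltaP_relators) [:: (b, true)] : DeltaP)).
by rewrite mulgV -DeltaP_cons; apply/pres_piE; exact: pres_cancel.
Qed.

Lemma DeltaP_relator w : w \in DeltaP_relators ->
  (\pi_(presented DeltaP_relators) w : DeltaP) = 1.
Proof. by move=> wr; apply/pres_piE/pres_rel. Qed.

Lemma DeltaP_relx : Dx * (Dy * Dy) = (Dy * Dy)^-1 * Dx.
Proof.
have := @DeltaP_relator (head [::] DeltaP_relators) (mem_head _ _).
rewrite !DeltaP_cons DeltaP_invE; exact: relator_flip.
Qed.

Lemma DeltaP_rely : Dy * (Dx * Dx) = (Dx * Dx)^-1 * Dy.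
Proof.
have := @DeltaP_relator (last [::] DeltaP_relators) (mem_last _ (behead DeltaP_relators)).
rewrite !DeltaP_cons DeltaP_invE; exact: relator_flip.
Qed.

Lemma DeltaP_nf (d : DeltaP) : has_nf Dx Dy d.
Proof.
elim/presented_ind: d => [|b s d IHd].
  have := has_nf_q Dx Dy false false; rewrite /= mulg1; exact.
case: b; case: s; rewrite ?DeltaP_invE.
- exact: has_nf_y DeltaP_relx DeltaP_rely _ IHd.
- exact: has_nf_yV DeltaP_relx DeltaP_rely _ IHd.
- exact: has_nf_x DeltaP_relx DeltaP_rely _ IHd.
- exact: has_nf_xV DeltaP_relx DeltaP_rely _ IHd.
Qed.

Section DeltaPMorphism.
Variables (H : groupType) (x y : H).
Hypothesis xY : x^-1 * (y * y) * x * (y * y) = 1.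
Hypothesis yX : y^-1 * (x * x) * y * (x * x) = 1.

Definition DeltaP_lift : DeltaP -> H := pres_lift (fun b : bool => if b then y else x).

Lemma DeltaP_lift_rel r : r \in DeltaP_relators ->
  word_eval (fun b : bool => if b then y else x) r = 1.
Proof.
rewrite !inE => /predU1P [->|/eqP ->].
  by rewrite /word_eval !big_cons big_nil /= mulg1 !mulgA -xY !mulgA.
by rewrite /word_eval !big_cons big_nil /= mulg1 !mulgA -yX !mulgA.
Qed.

Lemma DeltaP_liftM : {morph DeltaP_lift : a b / a * b}.
Proof. exact: pres_liftM DeltaP_lift_rel. Qed.

Lemma DeltaP_lift_x : DeltaP_lift Dx = x.
Proof.
by rewrite /DeltaP_lift pres_lift_pi; [rewrite /word_eval big_seq1 | exact: DeltaP_lift_rel].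
Qed.

Lemma DeltaP_lift_y : DeltaP_lift Dy = y.
Proof.
by rewrite /DeltaP_lift pres_lift_pi; [rewrite /word_eval big_seq1 | exact: DeltaP_lift_rel].
Qed.

End DeltaPMorphism.

(** * The Hantzsche-Wendt group as a group of isometries of R^3 *)

Definition flip (b : bool) (z : int) : int := if b then (- z)%R else z.

(* ((v1, v2, v3), (p, q)) stands for the isometry x |-> diag(s1, s2, s3) x + v / 2
   of R^3 with signs s1 = (-1)^q, s2 = (-1)^p and s3 = (-1)^(p + q). *)
Definition diag3 : Type := ((int * int * int) * (bool * bool))%type.

HB.instance Definition _ := Choice.copy diag3 ((int * int * int) * (bool * bool))%type.

Definition diag3_one : diag3 := ((0%R, 0%R, 0%R), (false, false)).
Definition diag3_mul (g h : diag3) : diag3 :=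
  let: ((v1, v2, v3), (p, q)) := g in
  let: ((w1, w2, w3), (p', q')) := h in
  (((v1 + flip q w1)%R, (v2 + flip p w2)%R, (v3 + flip (p (+) q) w3)%R),
   (p (+) p', q (+) q')).
Definition diag3_inv (g : diag3) : diag3 :=
  let: ((v1, v2, v3), (p, q)) := g in
  (((- flip q v1)%R, (- flip p v2)%R, (- flip (p (+) q) v3)%R), (p, q)).

Lemma diag3_mulA : associative diag3_mul.
Proof.
move=> [[[a1 a2] a3] [p q]] [[[b1 b2] b3] [p' q']] [[[c1 c2] c3] [p2 q2]] /=.
rewrite !addbA; congr (((_, _), _), _); rewrite /flip;
by case: p; case: q; case: p'; case: q' => /=; lia.
Qed.

Lemma diag3_mul1 : left_id diag3_one diag3_mul.
Proof. by move=> [[[a1 a2] a3] [p q]] /=; rewrite /flip /= !add0r. Qed.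

Lemma diag3_mulr1 : right_id diag3_one diag3_mul.
Proof.
move=> [[[a1 a2] a3] [p q]] /=; rewrite !addbF /flip oppr0 !if_same.
by rewrite !addr0.
Qed.

Lemma diag3_mulV : left_inverse diag3_one diag3_inv diag3_mul.
Proof. by move=> [[[a1 a2] a3] [p q]] /=; rewrite !addbb !addNr. Qed.

Lemma diag3_mulrV : right_inverse diag3_one diag3_inv diag3_mul.
Proof.
move=> [[[a1 a2] a3] [p q]] /=; rewrite !addbb /diag3_one.
by congr (((_, _), _), _); rewrite /flip; case: p; case: q => /=; lia.
Qed.

HB.instance Definition _ := isGroup.Build diag3
  diag3_mulA diag3_mul1 diag3_mulr1 diag3_mulV diag3_mulrV.

Definition hw_x : diag3 := ((1%R, 1%R, 0%R), (true, false)).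
Definition hw_y : diag3 := ((0%R, 1%R, 1%R), (false, true)).

(** The image of [hw_rep]: modulo 2 the translation part is a linear function of the holonomy,
    determined by [hw_x] and [hw_y]. *)
Definition hw_parity (g : diag3) :=
  let: ((v1, v2, v3), (p, q)) := g in
  [&& (2 %| (v1 - Posz p)%R)%Z, (2 %| (v2 - Posz (p (+) q))%R)%Z & (2 %| (v3 - Posz q)%R)%Z].

Definition hw_rep : DeltaP -> diag3 := DeltaP_lift hw_x hw_y.

Lemma hw_rep_rel1 : hw_x^-1 * (hw_y * hw_y) * hw_x * (hw_y * hw_y) = 1.
Proof. exact/eqP. Qed.
Lemma hw_rep_rel2 : hw_y^-1 * (hw_x * hw_x) * hw_y * (hw_x * hw_x) = 1.
Proof. exact/eqP. Qed.

Lemma hw_repM : {morph hw_rep : a b / a * b}.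
Proof. exact: DeltaP_liftM hw_rep_rel1 hw_rep_rel2. Qed.
Lemma hw_rep_x : hw_rep Dx = hw_x.
Proof. exact: DeltaP_lift_x hw_rep_rel1 hw_rep_rel2. Qed.
Lemma hw_rep_y : hw_rep Dy = hw_y.
Proof. exact: DeltaP_lift_y hw_rep_rel1 hw_rep_rel2. Qed.

Lemma expgz_diag3 v1 v2 v3 z :
  expgz (((v1, v2, v3), (false, false)) : diag3) z
  = ((v1 * z, v2 * z, v3 * z)%R, (false, false)).
Proof.
elim/expgz_ind: z => [|z IHz|z IHz]; first by rewrite !mulr0.
  by rewrite expgzS IHz; congr (((_, _), _), _) => /=; rewrite /flip; lia.
by rewrite expgzP IHz; congr (((_, _), _), _) => /=; rewrite /flip; lia.
Qed.

(** The square of [hw_x * hw_y] has third entry -2, hence the sign of [l]; the product itself has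
    third entry -1 = 1 - 2, hence the correction at [q1 && q2]. *)
Lemma hw_rep_nf i j l q1 q2 :
  hw_rep (promislow_nf Dx Dy i j l q1 q2) =
  ((i * 2 + Posz q1, j * 2 + Posz (q1 (+) q2), - l * 2 + (Posz q2 - (Posz (q1 && q2)) * 2))%R,
   (q1, q2)).
Proof.
rewrite /promislow_nf /promislow_T !hw_repM !(morph_expgz hw_repM) !(morph_X hw_repM).
rewrite !hw_repM hw_rep_x hw_rep_y.
have -> : hw_x * hw_x = ((2%R, 0%R, 0%R), (false, false)) by apply/eqP.
have -> : hw_y * hw_y = ((0%R, 2%R, 0%R), (false, false)) by apply/eqP.
have -> : hw_x * hw_y * (hw_x * hw_y) = ((0%R, 0%R, -2)%R, (false, false)) by apply/eqP.
rewrite !expgz_diag3.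
by case: q1; case: q2; congr (((_, _), _), _) => /=; rewrite /flip; lia.
Qed.

Lemma hw_rep_inj : injective hw_rep.
Proof.
apply: (morph_inj hw_repM) => d.
have [i [j [l [q1 [q2 ->]]]]] := DeltaP_nf d.
rewrite hw_rep_nf => -[] hi hj hl hq1 hq2; move: hi hj hl.
rewrite hq1 hq2 /= => hi hj hl.
have [-> -> ->] : [/\ i = 0%R, j = 0%R & l = 0%R] by split; lia.
by rewrite /promislow_nf /promislow_T /= !mulg1.
Qed.

Lemma hw_rep_surj g : hw_parity g -> exists d, hw_rep d = g.
Proof.
case: g => [[[v1 v2] v3] [p q]] /= /and3P [/dvdzP [i hi] /dvdzP [j hj] /dvdzP [l hl]].
exists (promislow_nf Dx Dy i j (- l - Posz (p && q))%R p q).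
rewrite hw_rep_nf; congr (((_, _), _), _); lia.
Qed.

(* Found by computer: pruning extremal points repeatedly from a box of the
   Hantzsche-Wendt group, then minimising what is left. *)
Definition hw_stuck : seq diag3 := [::
  ((-1, 1, -2)%R, (true, false)); ((-1, 1, 0)%R, (true, false));
  ((0, -1, -1)%R, (false, true)); ((1, 0, -1)%R, (true, true));
  ((1, 2, -1)%R, (true, true)); ((2, -1, -1)%R, (false, true))].

(** With [g = c a^-1], both [g a = c] and [g^-1 a = a c^-1 a] lie in the set, so [a] is not
    extremal. *)
Lemma hw_stuckP : all (fun a => hw_parity a &&
   has (fun c => (c != a) && (diag3_mul a (diag3_mul (diag3_inv c) a) \in hw_stuck)) hw_stuck) hw_stuck.
Proof. by vm_compute. Qed.

Lemma DeltaP_nondiffuse : ~ diffuse DeltaP.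
Proof.
have /choice [s sP] : forall a, exists d, a \in hw_stuck -> hw_rep d = a.
  move=> a.
  case: (boolP (a \in hw_stuck)) => ha; last by exists 1.
  have /andP [pa _] := allP hw_stuckP a ha.
  by have [d hd] := hw_rep_surj pa; exists d.
move=> dD; pose A := [fset d in [seq s a | a <- hw_stuck]]%fset.
have inA d : (d \in A) = (hw_rep d \in hw_stuck).
  apply/imfsetP/idP => /= [[e es ->]|hd].
    have /mapP [a ha ->] : e \in [seq s a | a <- hw_stuck] := es.
    by rewrite sP.
  exists d => //; suff hm : d \in [seq s a | a <- hw_stuck] by exact: hm.
  by apply/mapP; exists (hw_rep d) => //; apply: hw_rep_inj; rewrite sP.
have [|a [_ [_ [aA ea] _]]] := dD A.
  rewrite card_fseq undup_id ?size_map // map_inj_in_uniq // => a b ha hb /(congr1 hw_rep).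
  by rewrite !sP.
have ha : hw_rep a \in hw_stuck by rewrite -inA.
have /andP [_ /hasP [c hc /andP [ca hm]]] := allP hw_stuckP _ ha.
have g1 : s c * a^-1 != 1.
  by rewrite divg_eq1; apply: contra_neq ca => <-; rewrite sP.
have := ea _ g1; rewrite mulgVK !inA sP // hc invgF hw_repM hw_repM (morph_V hw_repM) sP //.
by rewrite -mulgA hm.
Qed.

(** * Diagonal extensions of C_2 x C_2 by a lattice *)

Definition oddint (z : int) : bool := ~~ (2 %| z)%Z.

Lemma oddintD y z : oddint (y + z)%R = oddint y (+) oddint z.
Proof. by rewrite /oddint; lia. Qed.

Lemma oddint_flip b z : oddint (flip b z) = oddint z.
Proof. by rewrite /oddint /flip; case: b; lia. Qed.

Lemma oddint_bool (b : bool) : oddint (Posz b) = b.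
Proof. by case: b. Qed.

Lemma oddintN_half z : ~~ oddint z -> exists c : int, z = (2 * c)%R.
Proof. by rewrite negbK => /dvdzP [c ->]; exists c; rewrite mulrC. Qed.

Fixpoint lexpos (s : seq int) : bool :=
  if s is z :: s' then (0 < z)%R || ((z == 0%R) && lexpos s') else false.

Lemma lexpos_add (I : Type) (f g : I -> int) (s : seq I) :
  lexpos (map f s) -> lexpos (map g s) -> lexpos [seq (f i + g i)%R | i <- s].
Proof.
elim: s => //= i s IHs /orP [fi|/andP [/eqP fi fs]] /orP [gi|/andP [/eqP gi gs]].
- by rewrite addr_gt0.
- by rewrite gi addr0 fi.
- by rewrite fi add0r gi.
- by rewrite fi gi eqxx IHs ?orbT.
Qed.

Lemma lexpos_total (I : Type) (f : I -> int) (s : seq I) :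
  ~~ lexpos (map f s) -> ~~ lexpos [seq (- f i)%R | i <- s] ->
  all (fun i => f i == 0%R) s.
Proof.
elim: s => //= i s IHs; rewrite !negb_or !negb_and -!leNgt oppr_le0.
move=> /andP [fi fs] /andP [gi gs].
have fi0 : f i == 0%R by rewrite eq_le fi gi.
rewrite fi0 /= in fs; rewrite oppr_eq0 fi0 /= in gs.
by rewrite fi0 IHs.
Qed.

(* A torsion-free extension G of C_2 x C_2 by a lattice, in coordinates: the
   element g acts on R^n by x |-> diag(+-1) x + u g / 2, where the signs are
   sgn g and where k1, k2 : G -> C_2 are the two components of the holonomy. *)
Record diag_data (G : groupType) (n : nat) := DiagData {
  k1 : G -> bool;
  k2 : G -> bool;
  al : 'I_n -> bool;
  be : 'I_n -> bool;
  u : G -> 'I_n -> int;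
  ga : G;
  gb : G;
  k1M : forall x y, k1 (x * y) = k1 x (+) k1 y;
  k2M : forall x y, k2 (x * y) = k2 x (+) k2 y;
  uM : forall x y i, u (x * y) i =
    (u x i + flip ((k1 x && al i) (+) (k2 x && be i)) (u y i))%R;
  u_ker : forall g, ~~ k1 g -> ~~ k2 g -> (forall i, u g i = 0%R) -> g = 1;
  u_even : forall g i, ~~ k1 g -> ~~ k2 g -> ~~ oddint (u g i);
  u_lat : forall c : 'I_n -> int, exists g,
    [/\ ~~ k1 g, ~~ k2 g & forall i, u g i = (2 * c i)%R];
  k1a : k1 ga; k2a : ~~ k2 ga; k1b : ~~ k1 gb; k2b : k2 gb;
  par_a : forall i, ~~ al i -> be i -> ~~ oddint (u gb i);
  par_b : forall i, al i -> ~~ be i -> oddint (u ga i) = oddint (u gb i);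
  par_c : forall i, al i -> be i -> ~~ oddint (u ga i);
  diag_torsion_free : torsion_free G
}.

Section DiagData.
Variables (G : groupType) (n : nat) (D : diag_data G n).
Local Notation k1 := (k1 D).
Local Notation k2 := (k2 D).
Local Notation al := (al D).
Local Notation be := (be D).
Local Notation u := (u D).
Local Notation ga := (ga D).
Local Notation gb := (gb D).

Definition sgn (g : G) (i : 'I_n) : bool := (k1 g && al i) (+) (k2 g && be i).

Lemma u_M x y i : u (x * y) i = (u x i + flip (sgn x i) (u y i))%R.
Proof. exact: uM. Qed.

Lemma k1_1 : k1 1 = false.
Proof. by have := k1M D 1 1; rewrite mulg1; case: (k1 1). Qed.
Lemma k2_1 : k2 1 = false.
Proof. by have := k2M D 1 1; rewrite mulg1; case: (k2 1). Qed.
Lemma k1_V x : k1 x^-1 = k1 x.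
Proof. by have := k1M D x^-1 x; rewrite mulVg k1_1; do 2!case: (k1 _). Qed.
Lemma k2_V x : k2 x^-1 = k2 x.
Proof. by have := k2M D x^-1 x; rewrite mulVg k2_1; do 2!case: (k2 _). Qed.

Lemma sgnM x y i : sgn (x * y) i = sgn x i (+) sgn y i.
Proof.
rewrite /sgn k1M k2M.
by case: (k1 x); case: (k1 y); case: (k2 x); case: (k2 y); case: (al i); case: (be i).
Qed.

Lemma u_1 i : u 1 i = 0%R.
Proof.
have := u_M 1 1 i; rewrite mulg1 /sgn k1_1 k2_1 /flip /= => h.
by apply: (addrI (u 1 i)); rewrite -h addr0.
Qed.

Lemma u_V x i : u x^-1 i = (- flip (sgn x i) (u x i))%R.
Proof.
have := u_M x^-1 x i; rewrite mulVg u_1 /sgn k1_V k2_V -/(sgn x i) => h.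
by apply/eqP; rewrite -addr_eq0 -h.
Qed.

Lemma u_inj g h : k1 g = k1 h -> k2 g = k2 h -> (forall i, u g i = u h i) -> g = h.
Proof.
move=> e1 e2 eu; apply: divg1_eq; apply: (u_ker (d := D)).
- by rewrite k1M k1_V e1 addbb.
- by rewrite k2M k2_V e2 addbb.
- move=> i; rewrite u_M u_V eu /sgn e1 e2 -/(sgn h i) /flip.
  by case: (sgn h i); lia.
Qed.

Definition pu g i := oddint (u g i).

Lemma puM x y i : pu (x * y) i = pu x i (+) pu y i.
Proof. by rewrite /pu u_M oddintD oddint_flip. Qed.

Lemma pu_lattice g i : ~~ k1 g -> ~~ k2 g -> pu g i = false.
Proof. by move=> h1 h2; apply/negbTE/u_even. Qed.

(** Parity is additive and vanishes on the lattice, so it factors through the holonomy; [h] brings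
    [g] back into the lattice. *)
Lemma puE g i : pu g i = (k1 g && pu ga i) (+) (k2 g && pu gb i).
Proof.
pose h := g * (if k1 g then ga else 1) * (if k2 g then gb else 1).
have pu1 : pu 1 i = false by rewrite pu_lattice ?k1_1 ?k2_1.
have : pu h i = false.
  rewrite pu_lattice // /h ?k1M ?k2M.
    have := k1a D; have := k1b D.
    by case: (k1 g); case: (k2 g); rewrite ?k1_1; do 2?[case: (k1 _)].
  have := k2a D; have := k2b D.
  by case: (k1 g); case: (k2 g); rewrite ?k2_1; do 2?[case: (k2 _)].
rewrite /h !puM; case: (k1 g); case: (k2 g); rewrite ?pu1 /=;
by do 3?[case: (pu _ i)].
Qed.

Lemma lattice_adjust g (v : 'I_n -> int) : (forall i, oddint (v i) = pu g i) ->
  exists h, [/\ k1 h = k1 g, k2 h = k2 g & forall i, u h i = v i].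
Proof.
move=> hv.
have /choice [c hc] : forall i, exists c : int, (v i - u g i = 2 * c)%R.
  move=> i; apply: oddintN_half.
  by have := hv i; rewrite /pu /oddint; lia.
have [l [l1 l2 lu]] := u_lat D c.
exists (l * g); rewrite k1M k2M (negbTE l1) (negbTE l2); split=> // i.
by rewrite u_M /sgn (negbTE l1) (negbTE l2) /flip /= lu -hc subrK.
Qed.

(** If all coordinates fixed by [g] were even, a lattice translation would make them zero; the
    resulting [h] would be a nontrivial element of order two. *)
Lemma torsion_free_pu g : k1 g || k2 g -> exists i, ~~ sgn g i /\ pu g i.
Proof.
move=> kg; apply: contrapT => nh.
have [h [h1 h2 hu]] : exists h, [/\ k1 h = k1 g, k2 h = k2 g
    & forall i, u h i = if sgn g i then u g i else 0%R].
  apply: lattice_adjust => i; case: ifP => // sg.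
  by apply/esym/negbTE/negP => pg; apply: nh; exists i; rewrite sg.
have h1' : h = 1.
  (* The exponent is 2, since [torsion_free] speaks of [x ^+ n.+1]. *)
  apply: (@diag_torsion_free _ _ D h 1%N); apply: (u_ker (d := D)).
  - by rewrite expg2 k1M addbb.
  - by rewrite expg2 k2M addbb.
  move=> i; rewrite expg2 u_M !hu /sgn h1 h2 -/(sgn g i) /flip.
  by case: (sgn g i); rewrite ?subrr ?addr0.
by move: kg; rewrite -h1 -h2 h1' k1_1 k2_1.
Qed.

Lemma diffuse_of_odd_trivial g0 i0 : ~~ al i0 -> ~~ be i0 -> pu g0 i0 -> diffuse G.
Proof.
move=> ai bi pg.
have sgn0 g : sgn g i0 = false by rewrite /sgn (negbTE ai) (negbTE bi) !andbF.
have pab : pu ga i0 || pu gb i0.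
  move: pg; rewrite puE; case: (pu ga i0) => //; case: (pu gb i0) => //.
  by rewrite !andbF.
(* The parity of coordinate [i0] is a nonzero functional on the holonomy; [h] represents the
   nontrivial element of its kernel. *)
pose h := if ~~ pu ga i0 then ga else if ~~ pu gb i0 then gb else ga * gb.
have hk : k1 h || k2 h.
  by rewrite /h; case: ifP => _; [|case: ifP => _]; rewrite ?k1M ?k2M
    ?(k1a D) ?(k2b D) ?(negbTE (k1b D)) ?orbT.
have [j [sj pj]] := torsion_free_pu hk.
have kdep g : pu g i0 = false ->
    (k1 g = false /\ k2 g = false) \/ (k1 g = k1 h /\ k2 g = k2 h).
  move=> pg0; move: pg0 pab; rewrite puE /h.
  case: (pu ga i0); case: (pu gb i0) => //=; rewrite ?k1M ?k2M
    ?(k1a D) ?(k2b D) ?(negbTE (k1b D)) ?(negbTE (k2a D));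
  by case: (k1 g); case: (k2 g) => //= _ _; by [left | right].
have sgnj g : pu g i0 = false -> sgn g j = false.
  move=> /kdep [[e1 e2]|[e1 e2]]; rewrite /sgn e1 e2 //.
  exact: negbTE sj.
have pujk g : pu g i0 = false -> pu g j = false -> k1 g = false /\ k2 g = false.
  move=> /kdep [//|[e1 e2]]; rewrite puE e1 e2 -puE => pj0.
  by rewrite pj0 in pj.
have p0 g i : u g i = 0%R -> pu g i = false by rewrite /pu => ->.
(* Where the first entry vanishes, the holonomy is 1 or that of [h], so the second entry is
   additive. Where both vanish, oddness of [h] at [j] leaves trivial holonomy, and all entries are
   additive. *)
pose s g := [:: u g i0, u g j & [seq u g i | i <- enum 'I_n]].
apply: (@diffuse_of_cone _ (fun g => lexpos (s g))).
- move=> x y; rewrite /s /= u_M sgn0 /flip.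
  move=> /orP [xi|/andP [/eqP xi xs]] /orP [yi|/andP [/eqP yi ys]].
  + by rewrite addr_gt0.
  + by rewrite yi addr0 xi.
  + by rewrite xi add0r yi.
  rewrite xi yi addr0 eqxx /= u_M (sgnj _ (p0 _ _ xi)) /flip.
  move: xs ys => /orP [xj|/andP [/eqP xj xs]] /orP [yj|/andP [/eqP yj ys]].
  + by rewrite addr_gt0.
  + by rewrite yj addr0 xj.
  + by rewrite xj add0r yj.
  rewrite xj yj addr0 eqxx /=.
  have [kx1 kx2] := pujk x (p0 _ _ xi) (p0 _ _ xj).
  rewrite (@eq_map _ _ _ (fun i => (u x i + u y i)%R)) ?lexpos_add // => i.
  by rewrite u_M /sgn kx1 kx2.
- rewrite /s /= !u_1 /=.
  rewrite (@eq_map _ _ _ (fun=> 0%R)); first by elim: (enum _).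
  exact: u_1.
- move=> x x1; rewrite -[_ || _]negbK negb_or; apply/negP => /andP [xn].
  rewrite /s /= u_V sgn0 /flip; move: xn; rewrite /s /= !negb_or !negb_and -!leNgt oppr_le0.
  move=> /andP [xi xs] /andP [yi ys].
  have xi0 : u x i0 = 0%R by apply/eqP; rewrite eq_le xi yi.
  rewrite xi0 eqxx /= in xs; rewrite xi0 oppr0 eqxx /= in ys.
  move: xs ys; rewrite u_V (sgnj _ (p0 _ _ xi0)) /flip.
  rewrite !negb_or !negb_and -!leNgt oppr_le0.
  move=> /andP [xj xs] /andP [yj ys].
  have xj0 : u x j = 0%R by apply/eqP; rewrite eq_le xj yj.
  rewrite xj0 eqxx /= in xs; rewrite xj0 oppr0 eqxx /= in ys.
  have [kx1 kx2] := pujk x (p0 _ _ xi0) (p0 _ _ xj0).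
  move: ys; rewrite (@eq_map _ _ _ (fun i => (- u x i)%R)) => [ys|i]; last first.
    by rewrite u_V /sgn kx1 kx2.
  have /allP x0 := lexpos_total xs ys.
  move: x1; rewrite (@u_ker _ _ D x) ?kx1 ?kx2 ?eqxx // => i.
  by apply/eqP/x0; rewrite mem_enum.
Qed.

End DiagData.

(** * Splitting off the Promislow group *)

Lemma DeltaP_morph_eq (H : groupType) (f g : DeltaP -> H) :
  {morph f : x y / x * y} -> {morph g : x y / x * y} ->
  f Dx = g Dx -> f Dy = g Dy -> f =1 g.
Proof.
move=> fM gM fx fy; elim/presented_ind => [|b s d IHd].
  by rewrite (morph_1 fM) (morph_1 gM).
rewrite fM gM IHd; congr (_ * _).
by case: b; case: s; rewrite ?DeltaP_invE ?(morph_V fM) ?(morph_V gM) ?fx ?fy.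
Qed.

Lemma flipD b (y z : int) : flip b (y + z)%R = (flip b y + flip b z)%R.
Proof. by case: b; rewrite /flip ?opprD. Qed.

Lemma flip_addb b c (z : int) : flip (b (+) c) z = flip b (flip c z).
Proof. by case: b; case: c; rewrite /flip /= ?opprK. Qed.

Lemma card_split (n : nat) (P : pred 'I_n) (s : seq 'I_n) :
  uniq s -> (forall i, i \in s -> ~~ P i) ->
  (#|P| + size s + #|[pred i | ~~ P i & i \notin s]| = n)%N.
Proof.
move=> us sP.
have <- : #|s| = size s by apply/card_uniqP.
rewrite -[RHS]card_ord -(cardC P) -addnA; congr (_ + _)%N.
rewrite -(cardID (mem s) (predC P)); congr (_ + _)%N; apply: eq_card => i.
  by rewrite !inE andb_idl // => /sP.
by rewrite !inE andbC.
Qed.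

Section Splitting.
Variables (G : groupType) (n : nat) (D : diag_data G n).
Local Notation k1 := (k1 D).
Local Notation k2 := (k2 D).
Local Notation al := (al D).
Local Notation be := (be D).
Local Notation u := (u D).
Local Notation sgn := (sgn D).
Local Notation pu := (pu D).

Definition trivial_char : pred 'I_n := fun i => ~~ al i && ~~ be i.

Hypothesis even_triv : forall g i, trivial_char i -> pu g i = false.

(** Entries 0 and 1, not merely the right parities: the subtraction of the special coordinate then
    gives exactly zero, which makes the relators hold in [G]. *)
Let a_ex : exists a, [/\ k1 a = true, k2 a = false & forall i, u a i = Posz (pu (ga D) i)].
Proof.
have [|h [h1 h2 hu]] := @lattice_adjust _ _ D (ga D) (fun i => Posz (pu (ga D) i)).
  by move=> i; rewrite oddint_bool.
by exists h; rewrite h1 h2 (k1a D) (negbTE (k2a D)).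
Qed.

Let b_ex : exists b, [/\ k1 b = false, k2 b = true & forall i, u b i = Posz (pu (gb D) i)].
Proof.
have [|h [h1 h2 hu]] := @lattice_adjust _ _ D (gb D) (fun i => Posz (pu (gb D) i)).
  by move=> i; rewrite oddint_bool.
by exists h; rewrite h1 h2 (k2b D) (negbTE (k1b D)).
Qed.

(** Torsion-freeness at [ga] gives an odd coordinate that [ga] fixes; its character is nontrivial
    because trivial ones are even, and [par_a] settles the other parity. The next two use [gb] and
    [ga * gb]. *)
Let ia_ex : exists i, [/\ ~~ al i, be i, pu (ga D) i = true & pu (gb D) i = false].
Proof.
have [|i [si pi]] := @torsion_free_pu _ _ D (ga D); first by rewrite (k1a D).
move: si; rewrite /sgn (k1a D) (negbTE (k2a D)) /= addbF => ai.
have bi : be i.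
  by apply: contraLR pi => bi; rewrite even_triv // /trivial_char ai.
by exists i; split=> //; apply/negbTE/(par_a ai bi).
Qed.

Let ib_ex : exists i, [/\ al i, ~~ be i, pu (ga D) i = true & pu (gb D) i = true].
Proof.
have [|i [si pi]] := @torsion_free_pu _ _ D (gb D); first by rewrite (k2b D) orbT.
move: si; rewrite /sgn (k2b D) (negbTE (k1b D)) /= => bi.
have ai : al i.
  by apply: contraLR pi => ai; rewrite even_triv // /trivial_char ai.
by exists i; split=> //; rewrite -pi /pu; apply: (par_b ai bi).
Qed.

Let ic_ex : exists i, [/\ al i, be i, pu (ga D) i = false & pu (gb D) i = true].
Proof.
have [|i [si pi]] := @torsion_free_pu _ _ D (ga D * gb D).
  by rewrite k1M (k1a D) (negbTE (k1b D)).
move: si; rewrite sgnM /sgn (k1a D) (k2b D) (negbTE (k1b D)) (negbTE (k2a D)) /=.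
rewrite addbF => /negbTE ab.
have [ai bi] : al i /\ be i.
  have : ~~ trivial_char i.
    by apply: contraTN pi => ti; rewrite even_triv.
  by rewrite /trivial_char; move: ab; case: (al i); case: (be i).
have pa : pu (ga D) i = false by apply/negbTE/(par_c ai bi).
by exists i; split=> //; rewrite -pi puM pa.
Qed.

Let a := projT1 (cid a_ex).
Let b := projT1 (cid b_ex).
Let ia := projT1 (cid ia_ex).
Let ib := projT1 (cid ib_ex).
Let ic := projT1 (cid ic_ex).
Let aP : [/\ k1 a = true, k2 a = false & forall i, u a i = Posz (pu (ga D) i)] :=
  projT2 (cid a_ex).
Let bP : [/\ k1 b = false, k2 b = true & forall i, u b i = Posz (pu (gb D) i)] :=
  projT2 (cid b_ex).
Let iaP : [/\ ~~ al ia, be ia, pu (ga D) ia = true & pu (gb D) ia = false] :=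
  projT2 (cid ia_ex).
Let ibP : [/\ al ib, ~~ be ib, pu (ga D) ib = true & pu (gb D) ib = true] :=
  projT2 (cid ib_ex).
Let icP : [/\ al ic, be ic, pu (ga D) ic = false & pu (gb D) ic = true] :=
  projT2 (cid ic_ex).

(** The order [ia], [ib], [ic] matches the signs (-1)^q, (-1)^p, (-1)^(p + q) of [diag3]. *)
Definition pr (g : G) : diag3 := ((u g ia, u g ib, u g ic), (k1 g, k2 g)).

Lemma sgn_ia g : sgn g ia = k2 g.
Proof. by case: iaP => ai bi _ _; rewrite /sgn (negbTE ai) bi andbF andbT. Qed.
Lemma sgn_ib g : sgn g ib = k1 g.
Proof. by case: ibP => ai bi _ _; rewrite /sgn (negbTE bi) ai andbF andbT addbF. Qed.
Lemma sgn_ic g : sgn g ic = k1 g (+) k2 g.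
Proof. by case: icP => ai bi _ _; rewrite /sgn ai bi !andbT. Qed.

Lemma prM : {morph pr : x y / x * y}.
Proof. by move=> x y; rewrite /pr !u_M sgn_ia sgn_ib sgn_ic k1M k2M. Qed.

Lemma pr_parity g : hw_parity (pr g).
Proof.
have p i c : pu g i = c -> (2 %| (u g i - Posz c)%R)%Z.
  by rewrite /pu /oddint => <-; case: (boolP (2 %| u g i)%Z) => /=; lia.
apply/and3P; split; apply: p; rewrite puE.
- by case: iaP => _ _ -> ->; rewrite andbT andbF addbF.
- by case: ibP => _ _ -> ->; rewrite !andbT.
- by case: icP => _ _ -> ->; rewrite andbT andbF.
Qed.

(* Subtracting the special coordinate that carries the same character removes
   the half-integral translation parts from all the other coordinates. *)
Definition special (i : 'I_n) : 'I_n := if ~~ al i then ia else if ~~ be i then ib else ic.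
Definition tw (i : 'I_n) : bool := pu (ga D) i || pu (gb D) i.
Definition w (g : G) (i : 'I_n) : int := (u g i - if tw i then u g (special i) else 0)%R.

(** For a trivial character [special i] is the arbitrary value [ia]; this keeps it out of [w]. *)
Lemma tw_trivial i : trivial_char i -> tw i = false.
Proof. by move=> ti; rewrite /tw !even_triv. Qed.

Lemma special_char i : ~~ trivial_char i -> al (special i) = al i /\ be (special i) = be i.
Proof.
rewrite /trivial_char /special; case: iaP ibP icP => a1 b1 _ _ [a2 b2 _ _] [a3 b3 _ _].
by case: (al i); case: (be i) => //= _; split=> //; apply/negbTE.
Qed.

(** By [par_a], [par_b] and [par_c], the parities at [ga] and [gb] of a coordinate with nontrivial
    character depend on one bit; [tw i] says that this bit is set, as it is for the special
    coordinate. *)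
Lemma special_pu g i : tw i -> pu g (special i) = pu g i.
Proof.
have [ti|nti] := boolP (trivial_char i); first by rewrite tw_trivial.
rewrite !(puE _ g) /tw; move: nti; rewrite /trivial_char /special.
have [[pa pb] pc] := (@par_a _ _ D i, @par_b _ _ D i, @par_c _ _ D i).
move: pa pb pc; rewrite -!/(pu _ _); case: (al i); case: (be i) => //= pa pb pc _.
- case: icP => _ _ -> ->; have := pc isT isT; rewrite -/(pu _ _) => /negbTE ->.
  by move=> /= ->.
- case: ibP => _ _ -> ->; have := pb isT isT; rewrite -!/(pu _ _) => ->.
  by rewrite orbb => ->.
- case: iaP => _ _ -> ->; have := pa isT isT; rewrite -/(pu _ _) => /negbTE ->.
  by rewrite orbF => ->.
Qed.

Lemma wM x y i : w (x * y) i = (w x i + flip (sgn x i) (w y i))%R.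
Proof.
rewrite /w !u_M.
have [ti|nti] := boolP (trivial_char i); first by rewrite tw_trivial // !subr0.
have -> : sgn x (special i) = sgn x i.
  by rewrite /sgn; have [-> ->] := special_char nti.
by case: (tw i); rewrite /flip; case: (sgn x i); lia.
Qed.

Lemma w_1 i : w 1 i = 0%R.
Proof. by rewrite /w !u_1 if_same subr0. Qed.

Lemma w_V x i : w x^-1 i = (- flip (sgn x i) (w x i))%R.
Proof.
have := wM x^-1 x i; rewrite mulVg w_1 /sgn k1_V k2_V -/(sgn x i) => h.
by apply/eqP; rewrite -addr_eq0 -h.
Qed.

Lemma w_even g i : exists c : int, w g i = (2 * c)%R.
Proof.
apply: oddintN_half; rewrite /w -[(- _)%R]/(flip true _) oddintD oddint_flip.
case: ifP => [ti|nti]; first by have := special_pu g ti; rewrite /pu => ->; rewrite addbb.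
move/negbT: nti; rewrite /tw negb_or => /andP [/negbTE pa /negbTE pb].
by rewrite -/(pu g i) puE pa pb !andbF.
Qed.

Lemma special_fix i : i \in [:: ia; ib; ic] -> special i = i.
Proof.
rewrite !inE /special; case: iaP ibP icP => a1 b1 _ _ [a2 b2 _ _] [a3 b3 _ _].
case/or3P => /eqP ->; first by rewrite a1.
  by rewrite a2 b2.
by rewrite a3 b3.
Qed.

Lemma w_special g i : i \in [:: ia; ib; ic] -> w g i = 0%R.
Proof.
move=> si; rewrite /w special_fix //.
suff -> : tw i by rewrite subrr.
move: si; rewrite !inE /tw; case: iaP ibP icP => _ _ a1 b1 [_ _ a2 b2] [_ _ a3 b3].
by case/or3P => /eqP ->; rewrite ?a1 ?a2 ?b3 ?orbT.
Qed.

Lemma w_a i : w a i = 0%R.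
Proof.
case: aP => _ _ ua; rewrite /w !ua; case: ifP => [/(special_pu (ga D)) ->|]; first by rewrite subrr.
by rewrite /tw; case: (pu (ga D) i); rewrite // subr0.
Qed.

Lemma w_b i : w b i = 0%R.
Proof.
case: bP => _ _ ub; rewrite /w !ub; case: ifP => [/(special_pu (gb D)) ->|]; first by rewrite subrr.
by rewrite /tw; case: (pu (gb D) i); rewrite ?orbT // subr0.
Qed.

Lemma coord_inj g h : pr g = pr h -> (forall i, w g i = w h i) -> g = h.
Proof.
move=> [ea eb ec e1 e2] ew; apply: (@u_inj _ _ D) => // i.
have := ew i; rewrite /w; case: ifP => _; last by rewrite !subr0.
have -> : u g (special i) = u h (special i).
  by rewrite /special; case: ifP => _; [|case: ifP => _].
by move/addIr.
Qed.

Lemma exists_w (c : 'I_n -> int) : (forall i, i \in [:: ia; ib; ic] -> c i = 0%R) ->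
  exists g, pr g = 1 /\ forall i, w g i = (2 * c i)%R.
Proof.
move=> cs; have [g [g1 g2 gu]] := u_lat D c.
have cs' i : u g (special i) = 0%R.
  rewrite gu cs ?mulr0 // /special.
  by case: ifP => _; [|case: ifP => _]; rewrite !inE eqxx ?orbT.
exists g; split; last by move=> i; rewrite /w cs' if_same subr0 gu.
by rewrite /pr !gu !cs ?inE ?eqxx ?orbT // mulr0 (negbTE g1) (negbTE g2).
Qed.

Lemma pr_a : pr a = hw_x.
Proof.
case: aP iaP ibP icP => ka1 ka2 ua [_ _ pa _] [_ _ pb _] [_ _ pc _].
by rewrite /pr !ua pa pb pc ka1 ka2.
Qed.

Lemma pr_b : pr b = hw_y.
Proof.
case: bP iaP ibP icP => kb1 kb2 ub [_ _ _ pa] [_ _ _ pb] [_ _ _ pc].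
by rewrite /pr !ub pa pb pc kb1 kb2.
Qed.

(** By [coord_inj] it suffices to test [pr] and [w]: under [pr] this is the relator for [hw_x] and
    [hw_y], and [w] is a cocycle that vanishes at [a] and [b]. *)
Lemma ab_rel1 : a^-1 * (b * b) * a * (b * b) = 1.
Proof.
apply: coord_inj => [|i]; last by rewrite !(wM, w_V) !w_a !w_b w_1 /flip !(if_same, oppr0, addr0).
rewrite !prM (morph_V prM) (morph_1 prM) pr_a pr_b; exact: hw_rep_rel1.
Qed.

Lemma ab_rel2 : b^-1 * (a * a) * b * (a * a) = 1.
Proof.
apply: coord_inj => [|i]; last by rewrite !(wM, w_V) !w_a !w_b w_1 /flip !(if_same, oppr0, addr0).
rewrite !prM (morph_V prM) (morph_1 prM) pr_a pr_b; exact: hw_rep_rel2.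
Qed.

Definition psi : DeltaP -> G := DeltaP_lift a b.

Lemma psiM : {morph psi : x y / x * y}.
Proof. exact: DeltaP_liftM ab_rel1 ab_rel2. Qed.

Lemma pr_psi d : pr (psi d) = hw_rep d.
Proof.
apply: (DeltaP_morph_eq (f := pr \o psi)).
- by move=> x y; rewrite /= psiM prM.
- exact: hw_repM.
- by rewrite /= /psi (DeltaP_lift_x ab_rel1 ab_rel2) pr_a hw_rep_x.
- by rewrite /= /psi (DeltaP_lift_y ab_rel1 ab_rel2) pr_b hw_rep_y.
Qed.

Lemma w_psi d i : w (psi d) i = 0%R.
Proof.
elim/presented_ind: d => [|c s d IHd]; first by rewrite (morph_1 psiM) w_1.
rewrite psiM wM IHd /flip oppr0 if_same addr0.
case: c; case: s; rewrite ?DeltaP_invE ?(morph_V psiM) ?w_V /psi.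
- by rewrite (DeltaP_lift_y ab_rel1 ab_rel2) w_b.
- by rewrite (DeltaP_lift_y ab_rel1 ab_rel2) w_b /flip oppr0 if_same oppr0.
- by rewrite (DeltaP_lift_x ab_rel1 ab_rel2) w_a.
- by rewrite (DeltaP_lift_x ab_rel1 ab_rel2) w_a /flip oppr0 if_same oppr0.
Qed.

Definition rest : pred 'I_n := fun i => ~~ trivial_char i && (i \notin [:: ia; ib; ic]).

Lemma special_nontrivial i : i \in [:: ia; ib; ic] -> ~~ trivial_char i.
Proof.
rewrite !inE /trivial_char; case: iaP ibP icP => a1 b1 _ _ [a2 b2 _ _] [a3 b3 _ _].
by case/or3P => /eqP ->; rewrite negb_and !negbK ?b1 ?a2 ?b3 ?orbT.
Qed.

Lemma uniq_special : uniq [:: ia; ib; ic].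
Proof.
case: iaP ibP icP => a1 b1 _ _ [a2 b2 _ _] [a3 b3 _ _].
rewrite /= !inE negb_or !andbT; rewrite -andbA; apply/and3P; split.
- by apply/eqP => e; move: a1; rewrite e a2.
- by apply/eqP => e; move: a1; rewrite e a3.
- by apply/eqP => e; move: b2; rewrite e b3.
Qed.

Lemma card_rest : (#|trivial_char| + 3 + #|rest| = n)%N.
Proof. exact: (card_split uniq_special special_nontrivial). Qed.

Section Isomorphism.
Variables (r : nat) (idx : 'I_r -> 'I_n).
Hypothesis idx_inj : injective idx.
Hypothesis idx_rest : forall j, rest (idx j).
Hypothesis rest_idx : forall i, rest i -> exists j, i = idx j.

Definition coef (v : 'rV[int]_r) (i : 'I_n) : int :=
  (\sum_(j < r) v 0 j *+ (idx j == i))%R.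

Lemma coef_idx v j : coef v (idx j) = v 0%R j.
Proof.
rewrite /coef (bigD1 j) //= eqxx mulr1n big1 ?addr0 // => j' jj'.
by rewrite (inj_eq idx_inj) (negbTE jj') mulr0n.
Qed.

Lemma coef_out v i : ~~ rest i -> coef v i = 0%R.
Proof.
move=> nri; rewrite /coef big1 // => j _.
by case: eqP => [e|]; [move: nri; rewrite -e idx_rest | rewrite mulr0n].
Qed.

Let N_ex v : exists g, pr g = 1 /\ forall i, w g i = (2 * coef v i)%R.
Proof. by apply: exists_w => i si; rewrite coef_out // /rest si andbF. Qed.

Definition Nrest v : G := projT1 (cid (N_ex v)).
Lemma pr_N v : pr (Nrest v) = 1.
Proof. by case: (projT2 (cid (N_ex v))). Qed.
Lemma w_N v i : w (Nrest v) i = (2 * coef v i)%R.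
Proof. by case: (projT2 (cid (N_ex v))). Qed.

Definition sgnd (d : DeltaP) (i : 'I_n) : bool :=
  ((hw_rep d).2.1 && al i) (+) ((hw_rep d).2.2 && be i).

Lemma sgn_pr g i : sgn g i = ((pr g).2.1 && al i) (+) ((pr g).2.2 && be i).
Proof. by []. Qed.

Lemma sgnd_psi d i : sgnd d i = sgn (psi d) i.
Proof. by rewrite sgn_pr pr_psi. Qed.

Definition rest_act (d : DeltaP) (v : 'rV[int]_r) : 'rV[int]_r :=
  (\row_j flip (sgnd d (idx j)) (v 0 j))%R.

Lemma rest_act1 v : rest_act 1 v = v.
Proof.
apply/rowP => j; rewrite mxE sgnd_psi (morph_1 psiM).
by rewrite /sgn k1_1 k2_1.
Qed.

Lemma rest_actM c d v : rest_act (c * d) v = rest_act c (rest_act d v).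
Proof. by apply/rowP => j; rewrite !mxE !sgnd_psi psiM sgnM flip_addb. Qed.

Lemma rest_actD d v v' : rest_act d (v + v')%R = (rest_act d v + rest_act d v')%R.
Proof. by apply/rowP => j; rewrite !mxE flipD. Qed.

Definition rest_action : automorphic_action DeltaP 'rV[int]_r :=
  AutomorphicAction rest_act1 rest_actM rest_actD.

(** The elements [Nrest v] come from a choice, but [pr] and [w] determine them, so they multiply
    like vectors. *)
Lemma NrestD v v' : Nrest (v + v')%R = Nrest v * Nrest v'.
Proof.
apply: coord_inj => [|i]; first by rewrite prM !pr_N mulg1.
rewrite wM sgn_pr pr_N /flip /= !w_N -mulrDr; congr (_ * _)%R.
by rewrite /coef -big_split; apply: eq_bigr => j _; rewrite mxE mulrnDl.
Qed.

Lemma psi_Nrest d v : psi d * Nrest v = Nrest (rest_act d v) * psi d.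
Proof.
apply: coord_inj => [|i]; first by rewrite !prM !pr_N mulg1 mul1g.
rewrite !wM w_psi (sgn_pr (Nrest _)) pr_N /flip /= addr0 add0r !w_N.
have [/rest_idx [j ->]|nri] := boolP (rest i).
  by rewrite !coef_idx mxE sgnd_psi /flip; case: (sgn _ _); rewrite ?mulrN.
by rewrite !coef_out // mulr0 oppr0 if_same.
Qed.

Lemma centerP z : (z \in group_center G) =
  `[< pr z = 1 /\ forall i, ~~ trivial_char i -> w z i = 0%R >].
Proof.
apply/asboolP/asboolP => [zc|[pz wz] y]; last first.
  apply: coord_inj => [|i]; first by rewrite !prM pz mulg1 mul1g.
  rewrite !wM (sgn_pr z) pz {1}/flip /= [RHS]addrC; congr (_ + _)%R.
  have [ti|nti] := boolP (trivial_char i); last by rewrite wz // /flip oppr0 if_same.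
  by move: ti => /andP [/negbTE ai /negbTE bi]; rewrite /sgn ai bi !andbF.
have sz i : sgn z i = false.
  (* Commuting with the lattice vector whose entries are all 2 forces every sign of [z] to be
     trivial. *)
  have [l [l1 l2 lu]] := u_lat D (fun=> 1%R).
  have := congr1 (u^~ i) (zc l); rewrite /= !u_M !lu {2}/sgn (negbTE l1) (negbTE l2).
  by rewrite /flip /=; case: (sgn z i) => //; lia.
have kz : k1 z = false /\ k2 z = false by rewrite -sgn_ia -sgn_ib !sz.
(* Commuting with [ga] or [gb] gives [u z i = - u z i] wherever that element reverses coordinate
   [i]. *)
have uz i : ~~ trivial_char i -> u z i = 0%R.
  rewrite /trivial_char negb_and !negbK => /orP [ai|bi].
    have := congr1 (u^~ i) (zc (ga D)); rewrite /= !u_M sz.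
    by rewrite /sgn (k1a D) (negbTE (k2a D)) ai /flip /=; lia.
  have := congr1 (u^~ i) (zc (gb D)); rewrite /= !u_M sz.
  by rewrite /sgn (k2b D) (negbTE (k1b D)) bi /flip /=; lia.
split=> [|i nti].
  by case: kz => e1 e2; rewrite /pr e1 e2 !uz // special_nontrivial // !inE eqxx ?orbT.
rewrite /w !uz ?if_same ?subr0 // /trivial_char.
by have [-> ->] := special_char nti.
Qed.

Definition split_map (x : subgroup (group_center G) * sdprod rest_action) : G :=
  val x.1 * Nrest x.2.1 * psi x.2.2.

Lemma split_mapM : {morph split_map : x y / x * y}.
Proof.
move=> [z [v d]] [z' [v' d']].
have zc : forall y, val z' * y = y * val z' by apply/asboolP/(valP z').
transitivity (val z * val z' * Nrest (v + rest_act d v')%R * psi (d * d')) => //.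
rewrite NrestD psiM /split_map /=.
transitivity (val z * val z' * Nrest v * (Nrest (rest_act d v') * psi d) * psi d').
  by rewrite !mulgA.
rewrite -psi_Nrest -[val z * val z' * Nrest v]mulgA zc.
transitivity (val z * Nrest v * (val z' * psi d) * Nrest v' * psi d').
  by rewrite !mulgA.
by rewrite zc !mulgA.
Qed.

Lemma pr_split x : pr (split_map x) = hw_rep x.2.2.
Proof.
rewrite /split_map !prM pr_N pr_psi mulg1.
by have := valP x.1; rewrite /= centerP => /asboolP [-> _]; rewrite mul1g.
Qed.

Lemma w_split x i : w (split_map x) i = (w (val x.1) i + 2 * coef x.2.1 i)%R.
Proof.
have := valP x.1; rewrite /= centerP => /asboolP [pz _].
rewrite /split_map !wM w_psi /flip oppr0 if_same addr0 sgn_pr pz /=.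
by rewrite w_N.
Qed.

Lemma split_map_inj : injective split_map.
Proof.
apply: (morph_inj split_mapM) => -[z [v d]] h.
have hd : d = 1.
  by apply: hw_rep_inj; rewrite (morph_1 hw_repM) -[d]/((z, (v, d)).2.2) -pr_split h (morph_1 prM).
have hw i : (w (val z) i + 2 * coef v i = 0)%R.
  by rewrite -[val z]/(val (z, (v, d)).1) -[v in coef v]/((z, (v, d)).2.1) -w_split h w_1.
have := valP z; rewrite /= centerP => /asboolP [pz wz].
have hv : v = 0%R.
  apply/rowP => j; rewrite mxE; have := hw (idx j).
  have /andP [nt _] := idx_rest j.
  by rewrite wz // coef_idx add0r => /eqP; rewrite mulf_eq0 => /eqP.
have hz : z = 1.
  apply: val_inj; apply: coord_inj => [|i]; first by rewrite pz (morph_1 prM).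
  have := hw i; rewrite hv /coef big1; last by move=> j _; rewrite mxE mul0rn.
  by rewrite mulr0 addr0 => ->; rewrite w_1.
by rewrite hz hv hd.
Qed.

Lemma split_map_surj g : exists x, split_map x = g.
Proof.
have [d hd] := hw_rep_surj (pr_parity g).
have /choice [c hc] := w_even g.
have [z [pz wz]] : exists z, pr z = 1 /\
    forall i, w z i = (2 * if trivial_char i then c i else 0)%R.
  apply: exists_w => i si; rewrite ifN //; exact: special_nontrivial.
have zc : z \in group_center G.
  by rewrite centerP; apply/asboolP; split=> // i nti; rewrite wz ifN // mulr0.
exists (Sub z zc, ((\row_j c (idx j))%R, d)); apply: coord_inj => [|i].
  by rewrite pr_split.
rewrite w_split SubK /= wz.
have [ti|nti] := boolP (trivial_char i).
  by rewrite coef_out ?mulr0 ?addr0 -?hc // /rest ti.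
rewrite mulr0 add0r.
have [/rest_idx [j ->]|] := boolP (rest i); first by rewrite coef_idx mxE hc.
move=> nri; rewrite coef_out // mulr0; apply/esym/w_special.
by move: nri; rewrite /rest nti /= negbK.
Qed.

Lemma splitting : exists phi : automorphic_action DeltaP 'rV[int]_r,
  isomorphic G (subgroup (group_center G) * sdprod phi)%type.
Proof.
exists rest_action; apply: isomorphic_sym.
exact: isomorphic_of_bij split_mapM split_map_inj split_map_surj.
Qed.

End Isomorphism.

(** The inequality ensures that the truncated difference in the type of [phi] is the true one, the
    number of coordinates in [rest]. *)
Lemma trivial_char_splitting : (#|trivial_char| + 3 <= n)%N /\
  exists phi : automorphic_action DeltaP 'rV[int]_(n - #|trivial_char| - 3),
    isomorphic G (subgroup (group_center G) * sdprod phi)%type.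
Proof.
have cr := card_rest; split; first by rewrite -[X in (_ <= X)%N]cr leq_addr.
have -> : (n - #|trivial_char| - 3)%N = #|rest| by rewrite -subnDA -[X in (X - _)%N]cr addKn.
apply: (@splitting _ (fun j => enum_val j)) => [|j|i ri].
- exact: enum_val_inj.
- exact: (enum_valP j).
- by exists (enum_rank_in ri i); rewrite enum_rankK_in.
Qed.

End Splitting.

(** * The first Betti number *)

Section Abelianization.
Variable G : groupType.

Definition ab_pi (g : G) : abelianization G :=
  \pi_(quotient_group (derived_subgroup G)) g.

Lemma ab_piM : {morph ab_pi : x y / x * y}.
Proof. by move=> x y; apply/esym; exact: (@quot_mulE G (derived_subgroup G) x y). Qed.

Lemma ab_pi_eq1 g : (ab_pi g = 1) <-> g \in derived_subgroup G.
Proof.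
split=> [|gd].
  by move=> /esym /(@quot_piE G (derived_subgroup G) 1 g); rewrite invg1 mul1g.
by apply/esym/(@quot_piE G (derived_subgroup G) 1 g); rewrite invg1 mul1g.
Qed.

Lemma commg_derived (x y : G) : [~ x, y] \in derived_subgroup G.
Proof. by apply/asboolP => S; apply. Qed.

Section IntMorphism.
Variable f : G -> int.
Hypothesis fM : forall x y, f (x * y) = (f x + f y)%R.

Lemma imorph1 : f 1 = 0%R.
Proof. by apply: (addrI (f 1)); rewrite -fM mulg1 addr0. Qed.
Lemma imorphV x : f x^-1 = (- f x)%R.
Proof. by apply/eqP; rewrite -addr_eq0 -fM mulVg imorph1. Qed.
Lemma imorph_expgz x c : f (expgz x c) = (c * f x)%R.
Proof.
elim/expgz_ind: c => [|c IH|c IH]; first by rewrite imorph1 mul0r.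
  by rewrite expgzS fM IH mulrDl mul1r.
by rewrite expgzP fM IH imorphV mulrBl mul1r.
Qed.

Lemma imorph_prod (I : finType) (F : I -> G) :
  f (\prod_(i : I) F i) = (\sum_i f (F i))%R.
Proof. exact: (big_morph f fM imorph1). Qed.

Definition imorph_ker : {pred G} := fun x => f x == 0%R.

Lemma imorph_derived x : x \in derived_subgroup G -> f x = 0%R.
Proof.
have kM : mulg_closed imorph_ker.
  by move=> a b /eqP fa /eqP fb; apply/eqP; rewrite fM fa fb.
have k1 : 1 \in imorph_ker by apply/eqP/imorph1.
have kV : invg_closed imorph_ker.
  by move=> a /eqP fa; apply/eqP; rewrite imorphV fa oppr0.
(* The derived subgroup is an intersection of subgroups, so the kernel of [f] is packed as one of
   them. *)
pose K : groupClosed G := HB.pack imorph_ker (isMulClosed.Build G imorph_ker kM)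
  (isMul1Closed.Build G imorph_ker k1) (isInvClosed.Build G imorph_ker kV).
move=> /asboolP /(_ K) h; apply/eqP/h => y z; apply/eqP.
by rewrite /commg /conjg !fM !imorphV; lia.
Qed.

End IntMorphism.
End Abelianization.

(** The rank is at most [m < r], so the rational left kernel has a nonzero row; multiplying it by
    the product of its denominators makes it integral. *)
Lemma int_dependence (r m : nat) (U : 'I_r -> 'I_m -> int) : (m < r)%N ->
  exists c : 'I_r -> int, (exists i, c i != 0%R) /\
    forall j, (\sum_(i < r) c i * U i j = 0)%R.
Proof.
move=> mr; pose A : 'M[rat]_(r, m) := (\matrix_(i, j) (U i j)%:~R)%R.
have kA : kermx A != 0%R.
  rewrite kermx_eq0 /row_free; apply/negP => /eqP e.
  by have := rank_leq_col A; rewrite e leqNgt mr.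
have [i0 [l hl]] : exists i0 l, kermx A i0 l != 0%R.
  apply: contrapT => h; case/negP: kA; apply/eqP/matrixP => i j; rewrite [RHS]mxE.
  by apply: contrapT => /eqP hij; apply: h; exists i, j.
pose q i : rat := kermx A i0 i.
have hq j : (\sum_i q i * (U i j)%:~R = 0)%R.
  have /matrixP /(_ i0 j) := mulmx_ker A; rewrite [LHS]mxE [RHS]mxE => h.
  by rewrite -[RHS]h; apply: eq_bigr => i _; rewrite [A i j]mxE.
pose d := (\prod_i denq (q i))%R.
have d0 : d != 0%R by apply/prodf_neq0 => i _; apply: denq_neq0.
pose c i : int := (numq (q i) * \prod_(i' | i' != i) denq (q i'))%R.
have cE i : ((c i)%:~R = q i * d%:~R :> rat)%R.
  have -> : d = (denq (q i) * \prod_(i' | i' != i) denq (q i'))%R.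
    by rewrite /d (bigD1 i).
  rewrite /c !rmorphM /= mulrA; congr (_ * _)%R.
  by rewrite -{2}(divq_num_den (q i)) mulfVK // intr_eq0 denq_neq0.
exists c; split.
  exists l; have : ((c l)%:~R != 0 :> rat)%R.
    by rewrite cE mulf_neq0 // intr_eq0.
  by rewrite intr_eq0.
move=> j; apply/eqP; rewrite -(intr_eq0 rat) rmorph_sum /=; apply/eqP.
transitivity (d%:~R * \sum_i q i * (U i j)%:~R)%R; last by rewrite hq mulr0.
rewrite mulr_sumr; apply: eq_bigr => i _.
by rewrite intrM cE; ring.
Qed.

Section Betti.
Variables (G : groupType) (n : nat) (D : diag_data G n).

(** The commutator of a lattice element with [g] multiplies by -2 the entries that [g] reverses and
    kills the others. Lattice entries being even, every multiple of 4 is reached. *)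
Lemma k0_derived l : ~~ k1 D l -> ~~ k2 D l ->
  (forall i, (4 %| u D l i)%Z) -> (forall i, trivial_char D i -> u D l i = 0%R) ->
  l \in derived_subgroup G.
Proof.
move=> l1 l2 l4 lt.
have /choice [c hc] : forall i, exists c : int, u D l i = (4 * c)%R.
  by move=> i; case/dvdzP: (l4 i) => c ->; exists c; rewrite mulrC.
have c1 (g h : G) : k1 D [~ h, g] = false.
  by rewrite /commg /conjg !k1M !k1_V; case: (k1 D h); case: (k1 D g).
have c2 (g h : G) : k2 D [~ h, g] = false.
  by rewrite /commg /conjg !k2M !k2_V; case: (k2 D h); case: (k2 D g).
have comm (g h : G) i : ~~ k1 D h -> ~~ k2 D h ->
    u D [~ h, g] i = (- u D h i + flip (sgn D g i) (u D h i))%R.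
  move=> h1 h2; rewrite /commg /conjg !u_M !u_V.
  rewrite /sgn !k1_V !k2_V (negbTE h1) (negbTE h2) /= -/(sgn D g i) /flip.
  by case: (sgn D g i) => /=; lia.
(* The coordinates reversed by [ga] are left to [h], the other nontrivial ones to [h']. *)
have [h [h1 h2 hu]] := u_lat D (fun i => if al D i then (- c i)%R else 0%R).
have [h' [h1' h2' hu']] := u_lat D (fun i => if al D i then 0%R else (- c i)%R).
have -> : l = [~ h, ga D] * [~ h', gb D].
  apply: (u_inj (D := D)).
  - by rewrite k1M !c1 (negbTE l1).
  - by rewrite k2M !c2 (negbTE l2).
  move=> i; rewrite u_M !comm //.
  have -> : sgn D [~ h, ga D] i = false.
    by rewrite /sgn c1 c2.
  rewrite hu hu' hc /sgn (k1a D) (k2b D) (negbTE (k2a D)) (negbTE (k1b D)) /= addbF /flip.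
  case: (boolP (al D i)) => ai; case: (boolP (be D i)) => bi; rewrite ?mulr0; try lia.
  by have := hc i; rewrite lt /trivial_char ?ai ?bi //; lia.
by rewrite gpredM // commg_derived.
Qed.

Lemma betti1_trivial k : betti1 G k -> k = #|trivial_char D|.
Proof.
case=> -[a aind] kmax.
have uT i : trivial_char D i -> forall x y, u D (x * y) i = (u D x i + u D y i)%R.
  by move=> /andP [/negbTE ai /negbTE bi] x y; rewrite uM ai bi !andbF.
apply/eqP; rewrite eqn_leq; apply/andP; split; last first.
  (* Lower bound: lattice vectors along the trivial coordinates stay independent in the
     abelianization, since these coordinates are morphisms to Z. *)
  pose t (j : 'I_#|trivial_char D|) : 'I_n := enum_val j.
  have tT j : trivial_char D (t j) by exact: (enum_valP j).
  have /choice [e he] : forall j, exists e, forall i, u D e i = (2 * Posz (i == t j))%R.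
    by move=> j; have [e [_ _ he]] := u_lat D (fun i => Posz (i == t j)); exists e.
  apply: (kmax _ (fun j => ab_pi (e j))) => c hc j.
  have : \prod_j expgz (e j) (c j) \in derived_subgroup G.
    apply/ab_pi_eq1; rewrite -hc (big_morph _ (@ab_piM G) (morph_1 (@ab_piM G))).
    by apply: eq_bigr => j' _; rewrite (morph_expgz (@ab_piM G)).
  move/(imorph_derived (uT _ (tT j))); rewrite (imorph_prod (uT _ (tT j))).
  rewrite (bigD1 j) //= big1 ?addr0 => [|j' jj'].
    by rewrite (imorph_expgz (uT _ (tT j))) he eqxx; lia.
  rewrite (imorph_expgz (uT _ (tT j))) he.
  by rewrite (inj_eq enum_val_inj) eq_sym (negbTE jj') !mulr0.
rewrite leqNgt; apply/negP => lt.
pose g i : G := repr (a i).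
pose t (j : 'I_#|trivial_char D|) : 'I_n := enum_val j.
have tT j : trivial_char D (t j) by exact: (enum_valP j).
(* Upper bound: a relation between the trivial coordinates of too many elements, multiplied by 4,
   becomes a relation in the abelianization. *)
have [c [[i0 ci0] hc]] := int_dependence (fun i j => u D (g i) (t j)) lt.
have sq x : ~~ k1 D (x * x) /\ ~~ k2 D (x * x) by rewrite k1M k2M !addbb.
pose M (x : G) := [/\ ~~ k1 D x, ~~ k2 D x & forall i, (4 %| u D x i)%Z].
have M1 : M 1 by split=> [||i]; rewrite ?k1_1 ?k2_1 ?u_1.
have MM x y : M x -> M y -> M (x * y).
  move=> [x1 x2 x4] [y1 y2 y4]; split; rewrite ?k1M ?k2M.
  - by rewrite (negbTE x1) (negbTE y1).
  - by rewrite (negbTE x2) (negbTE y2).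
  move=> i; rewrite u_M /sgn (negbTE x1) (negbTE x2) /flip /=.
  by apply: rpredD.
have MV x : M x -> M x^-1.
  move=> [x1 x2 x4]; split; rewrite ?k1_V ?k2_V // => i.
  by rewrite u_V /sgn (negbTE x1) (negbTE x2) /flip /= rpredN.
have M4 x : M (expgz x 4%R).
  have -> : expgz x 4%R = (x * x) * (x * x) by rewrite /= !expgS expg0 mulg1 !mulgA.
  have [s1 s2] := sq x; split; rewrite ?k1M ?k2M ?addbb // => i.
  rewrite u_M {1}/sgn (negbTE s1) (negbTE s2) /flip /=.
  have := u_even i s1 s2; rewrite negbK => /dvdzP [y ->].
  by apply/dvdzP; exists y; lia.
have M4z x z : M (expgz x (4 * z)%R).
  elim/expgz_ind: z => [|z IH|z IH]; first by rewrite mulr0.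
    by rewrite mulrDr mulr1 expgzD; apply: MM.
  by rewrite mulrBr mulr1 expgzD expgzN; apply/MM/MV.
have : \prod_i expgz (a i) (4 * c i)%R = 1.
  transitivity (ab_pi (\prod_i expgz (g i) (4 * c i)%R)).
    rewrite (big_morph _ (@ab_piM G) (morph_1 (@ab_piM G))).
    by apply: eq_bigr => i _; rewrite (morph_expgz (@ab_piM G)) /ab_pi reprK.
  apply/ab_pi_eq1.
  have [P1 P2 P4] : M (\prod_i expgz (g i) (4 * c i)%R) by apply: big_ind.
  apply: k0_derived => // i ti.
  rewrite (imorph_prod (uT _ ti)).
  under eq_bigr => j _ do rewrite (imorph_expgz (uT _ ti)) -mulrA.
  have := hc (enum_rank_in (A := trivial_char D) ti i).
  by rewrite /t enum_rankK_in // -mulr_sumr => ->; rewrite mulr0.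
move=> /aind /(_ i0); move: ci0; case: (c i0) => //; lia.
Qed.

End Betti.

(** * Integral coordinates *)

Definition rflip (R : realType) (b : bool) (x : R) : R := (if b then - x else x)%R.

(* Moving the origin makes, for every nontrivial character, the translation
   part of one chosen element of the group vanish in the corresponding
   coordinates; all translation parts are then half-integers. *)
Lemma diag_data_of_real (R : realType) (G : groupType) (n : nat)
    (k1 k2 : G -> bool) (s : G -> 'I_n -> bool) (T : G -> 'I_n -> R) (a b : G) :
  (forall x y, k1 (x * y) = k1 x (+) k1 y) ->
  (forall x y, k2 (x * y) = k2 x (+) k2 y) ->
  (forall x y i, s (x * y) i = s x i (+) s y i) ->
  (forall x y i, T (x * y)%g i = T x i + rflip (s x i) (T y i))%R ->
  (forall g i, ~~ k1 g -> ~~ k2 g -> s g i = false) ->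
  (forall g i, ~~ k1 g -> ~~ k2 g -> exists z : int, T g i = z%:~R)%R ->
  (forall c : 'I_n -> int, exists g,
    [/\ ~~ k1 g, ~~ k2 g & forall i, T g i = (c i)%:~R])%R ->
  (forall g, ~~ k1 g -> ~~ k2 g -> (forall i, T g i = 0)%R -> g = 1) ->
  k1 a -> ~~ k2 a -> ~~ k1 b -> k2 b -> torsion_free G ->
  inhabited (diag_data G n).
Proof.
move=> k1M k2M sM TM sL TL Tlat Tker k1a k2a k1b k2b tf.
have k11 : k1 1 = false by have := k1M 1 1; rewrite mulg1; case: (k1 1).
have k21 : k2 1 = false by have := k2M 1 1; rewrite mulg1; case: (k2 1).
have s1 i : s 1 i = false by rewrite sL ?k11 ?k21.
have sE g i : s g i = (k1 g && s a i) (+) (k2 g && s b i).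
  pose h := g * (if k1 g then a else 1) * (if k2 g then b else 1).
  have : s h i = false.
    rewrite sL // /h ?k1M ?k2M.
      by move: k1a k1b; case: (k1 g); case: (k2 g); rewrite ?k11; do 2?[case: (k1 _)].
    by move: k2a k2b; case: (k1 g); case: (k2 g); rewrite ?k21; do 2?[case: (k2 _)].
  rewrite /h !sM; case: (k1 g); case: (k2 g); rewrite ?s1 /=;
  by do 3?[case: (s _ i)].
(* Two holonomy classes reverse a coordinate with nontrivial character; this choice gives the
   special coordinates the parities of [hw_x] and [hw_y]. *)
pose g0 i := if s a i then (if s b i then a else a * b) else b.
(* Moving the origin by [c i / 2] changes by [c i] the translation part of each element reversing
   coordinate [i]. *)
pose c i : R := (if s a i || s b i then T (g0 i) i else 0)%R.
pose T' g i : R := (T g i - if s g i then c i else 0)%R.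
have T'M x y i : T' (x * y) i = (T' x i + rflip (s x i) (T' y i))%R.
  rewrite /T' TM sM /rflip.
  by case: (s x i); case: (s y i) => /=; ring.
have sg0 i : s a i || s b i -> s (g0 i) i.
  by rewrite /g0; case: (boolP (s a i)) => // ai; case: (boolP (s b i)) => //= bi _; rewrite sM ai (negbTE bi).
have T'g0 i : s a i || s b i -> T' (g0 i) i = 0%R.
  by move=> ab; rewrite /T' sg0 // /c ab subrr.
have T'L g i : ~~ k1 g -> ~~ k2 g -> T' g i = T g i.
  by move=> h1 h2; rewrite /T' sL // subr0.
have kk x : ~~ k1 (x * x) /\ ~~ k2 (x * x) by rewrite k1M k2M !addbb.
(* If [g] fixes coordinate [i], then [2 * T' g i] is the entry of [g * g], which is a lattice
   element. *)
have half0 g i : s g i = false -> exists z : int, (2 * T' g i)%R = z%:~R%R.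
  move=> sg; have [h1 h2] := kk g; have [z hz] := TL _ i h1 h2.
  by exists z; rewrite -hz -(T'L _ _ h1 h2) T'M sg /rflip; ring.
have T'1 i : T' 1 i = 0%R.
  by have := T'M 1 1 i; rewrite mulg1 s1 /rflip => h; apply: (addrI (T' 1 i)); rewrite -h addr0.
(* If [g] reverses it, [g * g0 i] fixes it and has the same entry, because [T' (g0 i) i] is zero. *)
have half g i : exists z : int, (2 * T' g i)%R = z%:~R%R.
  have [sg|/negbTE sg] := boolP (s g i); last exact: half0.
  have ab : s a i || s b i.
    by move: sg; rewrite sE; case: (s a i) => //; case: (s b i) => //; rewrite !andbF.
  have [z hz] : exists z : int, (2 * T' (g * g0 i)%g i)%R = z%:~R%R.
    by apply: half0; rewrite sM sg sg0.
  by exists z; rewrite -hz T'M T'g0 // /rflip oppr0 if_same addr0.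
have /choice [u0 hu0] : forall p : G * 'I_n, exists z : int, (2 * T' p.1 p.2)%R = z%:~R%R.
  by move=> [g i]; exact: half.
pose u g i := u0 (g, i).
have hu g i : ((u g i)%:~R = 2 * T' g i :> R)%R by rewrite /u -(hu0 (g, i)).
have intI (y z : int) : (y%:~R = z%:~R :> R)%R -> y = z by move/eqP; rewrite eqr_int => /eqP.
have uM x y i : u (x * y) i
    = (u x i + flip ((k1 x && s a i) (+) (k2 x && s b i)) (u y i))%R.
  apply: intI; rewrite -sE intrD /flip.
  by case: (boolP (s x i)) => sx; rewrite ?intrN !hu T'M /rflip ?sx ?(negbTE sx); ring.
have zero g i : T' g i = 0%R -> u g i = 0%R.
  by move=> h; apply: intI; rewrite hu h mulr0.
have u_ker g : ~~ k1 g -> ~~ k2 g -> (forall i, u g i = 0%R) -> g = 1.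
  move=> h1 h2 ug; apply: Tker => // i; rewrite -T'L //.
  by have := hu g i; rewrite ug => /esym/eqP; rewrite mulf_eq0 pnatr_eq0 /= => /eqP.
have u_even g i : ~~ k1 g -> ~~ k2 g -> ~~ oddint (u g i).
  move=> h1 h2; have [z hz] := TL g i h1 h2.
  have -> : u g i = (2 * z)%R by apply: intI; rewrite hu T'L // hz intrM.
  by rewrite /oddint; lia.
have u_lat (d : 'I_n -> int) : exists g,
    [/\ ~~ k1 g, ~~ k2 g & forall i, u g i = (2 * d i)%R].
  have [g [h1 h2 hg]] := Tlat d; exists g; split=> // i.
  by apply: intI; rewrite hu T'L // hg intrM.
have par_a i : ~~ s a i -> s b i -> ~~ oddint (u b i).
  move=> ai bi; rewrite zero //.
  by have := @T'g0 i; rewrite /g0 (negbTE ai) bi => ->.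
have par_b i : s a i -> ~~ s b i -> oddint (u a i) = oddint (u b i).
  move=> ai bi; have := @T'g0 i; rewrite /g0 ai (negbTE bi) => /(_ isT) /zero.
  rewrite uM => h; have := oddintD (u a i) (flip ((k1 a && s a i) (+) (k2 a && s b i)) (u b i)).
  by rewrite h oddint_flip; case: (oddint (u a i)); case: (oddint (u b i)).
have par_c i : s a i -> s b i -> ~~ oddint (u a i).
  move=> ai bi; rewrite zero //.
  by have := @T'g0 i; rewrite /g0 ai bi => ->.
exists; exact: (@DiagData G n k1 k2 (s a) (s b) u a b k1M k2M uM u_ker u_even u_lat
  k1a k2a k1b k2b par_a par_b par_c tf).
Qed.

(** * Discreteness and cocompactness *)

Local Open Scope classical_set_scope.
Local Open Scope ring_scope.

Section Discrete.
Variables (R : realType) (n : nat) (Gamma : groupClosed (euclidean_isom R n)).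
Hypothesis dG : discrete_subgroup Gamma.

Lemma discrete_small : exists2 eps : R, 0 < eps &
  forall v : 'cV[R]_n, translation v \in Gamma ->
    (forall i, `|v i 0| < eps) -> v = 0.
Proof.
have : [set` Gamma] (1%g : euclidean_isom R n) by exact: gpred1.
rewrite -dG => -[_ [V V1 VG]].
case: V1 => -[A B] /= [/nbhs_ballP [e /= e0 eA] B1] ABV.
exists e => // v vG ve.
have : (V `&` [set` Gamma]) (translation v).
  split=> //; apply: ABV; split=> /=; last exact: nbhs_singleton.
  apply: eA; split=> // i j; rewrite ord1 /ball /= mxE sub0r normrN; exact: ve.
by rewrite VG => -[].
Qed.

(* Pigeonhole on the fractional parts of the multiples of a real relation: two
   multiples in the same small box differ by a short vector of the lattice. *)
Lemma discrete_independent (r : nat) (e : 'I_r -> 'cV[R]_n) :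
  (forall c : 'I_r -> int, translation (\sum_i e i *~ c i) \in Gamma) ->
  (forall c : 'I_r -> int, \sum_i e i *~ c i = 0 -> forall i, c i = 0) ->
  forall x : 'I_r -> R, \sum_i x i *: e i = 0 -> forall i, x i = 0.
Proof.
move=> eG eZ x0 x0e i0; apply: contrapT => /eqP xi0.
(* Entry [i0] becomes -1, so that the integral relation [c] found below has the nonzero entry
   [j - j'] there. *)
pose x i := - x0 i / x0 i0.
have xe : \sum_i x i *: e i = 0.
  transitivity ((- (x0 i0)^-1) *: \sum_i x0 i *: e i); last by rewrite x0e scaler0.
  by rewrite scaler_sumr; apply: eq_bigr => i _; rewrite scalerA /x; congr (_ *: _); ring.
have xN : x i0 = -1 by rewrite /x mulNr divff.
have [eps eps0 small] := discrete_small.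
pose S := \sum_i \sum_l `|e i l 0|.
have S0 : 0 <= S by apply: sumr_ge0 => i _; apply: sumr_ge0.
(* Two points in one cell of side [1 / q] give a lattice vector with entries at most
   [S / q < eps]. *)
pose q := (Num.truncn (S / eps)).+1.
have qS : S < eps * q%:R.
  by rewrite mulrC -ltr_pdivrMr // /q; apply: truncnS_gt.
pose frac (j : nat) i : R := j%:R * x i - (Num.floor (j%:R * x i))%:~R.
have frac0 j i : 0 <= frac j i by rewrite subr_ge0 floor_le.
have frac1 j i : frac j i < 1.
  by rewrite ltrBlDr addrC; have := floorD1_gt (j%:R * x i); rewrite intrD1.
pose cell (j : 'I_(#|{ffun 'I_r -> 'I_q}|.+1)) : {ffun 'I_r -> 'I_q} :=
  [ffun i => inord (Num.truncn (q%:R * frac j i))].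
have [j [j' [jj' cjj']]] : exists j j', j != j' /\ cell j = cell j'.
  apply: contrapT => h.
  have ci : injective cell.
    move=> j j' cjj; apply/eqP; apply: contrapT => /negP jj; apply: h.
    by exists j, j'.
  by have := leq_card _ ci; rewrite card_ord ltnn.
have close i : `|frac j i - frac j' i| * q%:R < 1.
  have := congr1 (fun F : {ffun 'I_r -> 'I_q} => val (F i)) cjj'.
  have q0 : 0 <= q%:R :> R by [].
  have fq k : 0 <= q%:R * frac k i by rewrite mulr_ge0.
  have tq k : (Num.truncn (q%:R * frac k i) < q)%N.
    by rewrite truncn_lt_nat // -[ltRHS]mulr1 ltr_pM2l // ltr0n.
  rewrite !ffunE /= !inordK ?tq // => tt.
  have /andP [a1 a2] := truncn_itv (fq j); have /andP [b1 b2] := truncn_itv (fq j').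
  rewrite -[X in _ * X]gtr0_norm ?ltr0n // -normrM ltr_norml.
  rewrite tt in a1 a2; rewrite -natr1 in a2; rewrite -natr1 in b2.
  by apply/andP; split; lra.
have fracE k : \sum_i frac k i *: e i = \sum_i e i *~ (- Num.floor (k%:R * x i)).
  transitivity (k%:R *: (\sum_i x i *: e i) + \sum_i e i *~ (- Num.floor (k%:R * x i))).
    rewrite scaler_sumr -big_split; apply: eq_bigr => i _.
    by rewrite /frac scalerBl scalerA mulrNz scaler_int.
  by rewrite xe scaler0 add0r.
pose c i := Num.floor (j'%:R * x i) - Num.floor (j%:R * x i).
have cE : \sum_i (frac j i - frac j' i) *: e i = \sum_i e i *~ c i.
  transitivity (\sum_i frac j i *: e i - \sum_i frac j' i *: e i).
    by rewrite -sumrB; apply: eq_bigr => i _; rewrite scalerBl.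
  rewrite !fracE -sumrB; apply: eq_bigr => i _.
  by rewrite -mulrzBr /c; congr (_ *~ _); ring.
have c0 : \sum_i e i *~ c i = 0.
  apply: small => // l; rewrite -cE summxE.
  apply: (@le_lt_trans _ _ (\sum_i (q%:R)^-1 * `|e i l 0|)).
    apply: le_trans (ler_norm_sum _ _ _) _; apply: ler_sum => i _.
    rewrite mxE normrM ler_wpM2r //.
    by rewrite -[leRHS]mul1r ler_pdivlMr ?ltr0n // ltW.
  rewrite -mulr_sumr mulrC ltr_pdivrMr ?ltr0n //; apply: le_lt_trans qS.
  apply: ler_sum => i _; rewrite (bigD1 l) //= lerDl.
  by apply: sumr_ge0.
have := eZ c c0 i0; rewrite /c xN !mulrN1.
have fl (k : nat) : Num.floor (- k%:R : R) = - k%:Z.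
  by rewrite -[k%:R]/(k%:Z%:~R) -intrN intrKfloor.
rewrite !fl => /eqP; rewrite opprK addrC subr_eq0 => /eqP [] jj.
by move/eqP: jj'; apply; apply/val_inj.
Qed.

End Discrete.

Lemma continuous_bigsum (T : topologicalType) (R : realType) (I : finType)
    (F : I -> T -> R) : (forall i, continuous (F i)) ->
  continuous (fun x => \sum_i F i x).
Proof.
move=> Fc; have : forall s : seq I, continuous (fun x => \sum_(i <- s) F i x).
  elim=> [|i s IHs] x.
    have -> : (fun x => \sum_(i <- [::]) F i x) = (fun=> 0).
      by apply/funext => y; rewrite big_nil.
    exact: cvg_cst.
  have -> : (fun x => \sum_(j <- i :: s) F j x) = F i \+ (fun x => \sum_(j <- s) F j x).
    by apply/funext => y; rewrite big_cons.
  by apply: cvgD; [exact: Fc | exact: IHs].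
exact.
Qed.

Section Cocompact.
Variables (R : realType) (n : nat) (Gamma : groupClosed (euclidean_isom R n)).
Variables (k1 k2 : subgroup Gamma -> bool).
Hypothesis k1M : forall x y, k1 (x * y)%g = k1 x (+) k1 y.
Hypothesis k2M : forall x y, k2 (x * y)%g = k2 x (+) k2 y.
Hypothesis kL : forall g, ~~ k1 g -> ~~ k2 g -> g \in lattice Gamma.
Variable gam : bool * bool -> subgroup Gamma.
Hypothesis gam1 : forall q, k1 (gam q) = q.1.
Hypothesis gam2 : forall q, k2 (gam q) = q.2.
Variable a : 'rV[R]_n.
Hypothesis aL : forall v : 'cV[R]_n, translation v \in Gamma -> a *m v = 0.

Definition functional (y : euclidean_isom R n) : R := (a *m y.1) 0 0.

Lemma functional_lattice l y : l \in lattice Gamma ->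
  functional (val l * y)%g = functional y.
Proof.
move=> /eqP; have := valP l; case: (val l) => v A /= vA A1.
rewrite A1 in vA *; rewrite /functional.
have -> : (((v, 1%g) : euclidean_isom R n) * y)%g.1 = v + y.1.
  by rewrite -[LHS]/(v + 1%:M *m y.1) mul1mx.
by rewrite mulmxDr aL // add0r.
Qed.

(* Up to lattice translations, on which the functional vanishes, the elements
   gam q * x^-1 represent the orbit of the point x^-1 0; hence this continuous
   function descends to the quotient by Gamma. *)
Definition orbit_height (x : euclidean_isom R n) : R :=
  \sum_q `|functional (val (gam q) * x^-1)%g|.

Lemma orbit_height_right x (g : subgroup Gamma) :
  orbit_height (x * val g)%g = orbit_height x.
Proof.
(* Right multiplication by [g] permutes the four holonomy classes, up to lattice elements that
   [functional] ignores. *)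
pose h (q : bool * bool) := (q.1 (+) k1 g, q.2 (+) k2 g).
have hK : involutive h by move=> [p q]; rewrite /h /= !addbK.
rewrite /orbit_height [RHS](reindex_inj (inv_inj hK)) /=.
apply: eq_bigr => q _; congr `|_|.
have k1V y : k1 y^-1%g = k1 y.
  have := k1M y^-1%g y; rewrite mulVg; have := k1M 1%g 1%g; rewrite mulg1.
  by case: (k1 1%g); case: (k1 y); case: (k1 _).
have k2V y : k2 y^-1%g = k2 y.
  have := k2M y^-1%g y; rewrite mulVg; have := k2M 1%g 1%g; rewrite mulg1.
  by case: (k2 1%g); case: (k2 y); case: (k2 _).
pose l := (gam q * g^-1 * (gam (h q))^-1)%g.
have lL : l \in lattice Gamma.
  apply: kL; rewrite ?k1M ?k2M ?k1V ?k2V ?gam1 ?gam2 /h /=.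
    by case: q.1; case: (k1 g).
  by case: q.2; case: (k2 g).
rewrite -(functional_lattice (val (gam (h q)) * x^-1)%g lL) /l; congr functional.
rewrite invgM !mulgA; congr (_ * _)%g.
have -> : val (gam q * g^-1 * (gam (h q))^-1)%g
  = (val (gam q) * (val g)^-1 * (val (gam (h q)))^-1)%g by [].
by rewrite mulgVK.
Qed.

(** The inverse of an orthogonal matrix is its transpose, so the expression is polynomial in the
    entries of [x]. *)
Lemma functional_continuous (g : euclidean_isom R n) :
  continuous (fun x : euclidean_isom R n => functional (g * x^-1)%g).
Proof.
have -> : (fun x : euclidean_isom R n => functional (g * x^-1)%g) = fun x =>
    (a *m g.1) 0 0 + \sum_i (- (a *m val g.2) 0 i) * \sum_j val x.2 j i * x.1 j 0.
  apply/funext => x; rewrite /functional.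
  have -> : (g * x^-1)%g.1 = g.1 + val g.2 *m (- ((val x.2)^T *m x.1)) by [].
  rewrite mulmxDr mulmxA mulmxN -mulNmx mxE; congr (_ + _).
  rewrite [LHS]mxE; apply: eq_bigr => i _; congr (_ * _).
    by rewrite [LHS]mxE.
  by rewrite [LHS]mxE; apply: eq_bigr => j _; rewrite [_^T i j]mxE.
move=> x; apply: cvgD; first exact: cvg_cst.
apply: continuous_bigsum => {x} i x; apply: cvgM; first exact: cvg_cst.
apply: continuous_bigsum => {x} j x; apply: cvgM.
  apply: (@continuous_comp _ _ _ snd (fun A : orthogonal_group R n => val A j i)).
    exact: cvg_snd.
  apply: (@continuous_comp _ _ _ (val : orthogonal_group R n -> 'M[R]_n) (fun A => A j i)).
    exact: initial_continuous.
  exact: coord_continuous.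
apply: (@continuous_comp _ _ _ fst (fun v : 'cV[R]_n => v j 0)).
  exact: cvg_fst.
exact: coord_continuous.
Qed.

Lemma orbit_height_continuous : continuous orbit_height.
Proof.
apply: continuous_bigsum => q x.
by apply: cvg_norm; apply: functional_continuous.
Qed.

(** Thus the lattice spans R^n. The function [orbit_height] is bounded, being continuous on a
    compact quotient, but at the inverse of a translation by [v] it is at least the absolute value
    of [a *m v]. *)
Lemma cocompact_functional0 : cocompact Gamma -> a = 0.
Proof.
move=> cG.
pose F : quotient_topology (cosets Gamma) -> R := orbit_height \o repr.
have Finv x y : \pi_(quotient_topology (cosets Gamma))%qT x
    = \pi_(quotient_topology (cosets Gamma))%qT y -> orbit_height x = orbit_height y.
  move=> /eqmodP xy.
  have xyG : (x^-1 * y)%g \in Gamma by exact: xy.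
  pose g : subgroup Gamma := exist (fun z => z \in Gamma) _ xyG.
  by rewrite -(orbit_height_right x g) -[val g]/(x^-1 * y)%g mulVKg.
have Fc : continuous F.
  apply: repr_comp_continuous; first exact: orbit_height_continuous.
  by move=> x y /eqP xy; apply/eqP/Finv.
have /compact_bounded [M [_ hM]] := continuous_compact (continuous_subspaceT Fc) cG.
(* [compact_bounded] bounds [F] by every number above [M], hence [M + 1]. *)
have bound x : orbit_height x <= M + 1.
  have -> : orbit_height x = F (\pi x)%qT by apply: Finv; rewrite reprK.
  apply: le_trans (ler_norm _) _; apply: (hM (M + 1)); first by rewrite ltrDl.
  by exists (\pi x)%qT.
have lb (v : 'cV[R]_n) : `|(a *m v) 0 0| <= M + 1.
  apply: le_trans (bound (translation v)^-1%g).
  rewrite /orbit_height (bigD1 (false, false)) //= invgK.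
  rewrite functional_lattice; last by apply: kL; rewrite ?gam1 ?gam2.
  by rewrite lerDl sumr_ge0.
have aa0 : 0 <= (a *m a^T) 0 0.
  by rewrite mxE; apply: sumr_ge0 => i _; rewrite mxE -expr2 sqr_ge0.
have aa : (a *m a^T) 0 0 = 0.
  apply: contrapT => /eqP aan0.
  have := lb (((M + 2) / (a *m a^T) 0 0) *: a^T).
  rewrite -scalemxAr mxE divfK // => h.
  by have := le_trans (ler_norm _) h; lra.
apply/rowP => i; rewrite mxE; apply/eqP; rewrite -sqrf_eq0 expr2.
move/eqP: aa; rewrite mxE psumr_eq0 => [/allP /(_ i)|j _]; last by rewrite mxE -expr2 sqr_ge0.
by rewrite mem_index_enum mxE => /(_ isT).
Qed.

End Cocompact.

(** * Coordinates with respect to a diagonal basis *)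

Section Translations.
Variables (R : realType) (n : nat).
Implicit Types (v w : 'cV[R]_n) (g : euclidean_isom R n).

Lemma translationD v w : translation (v + w) = (translation v * translation w)%g.
Proof.
rewrite -[RHS]/((v + 1%:M *m w, (1 * 1)%g) : euclidean_isom R n).
by rewrite mul1mx mulg1.
Qed.

Lemma translation0 : translation (0 : 'cV[R]_n) = 1%g.
Proof. by []. Qed.

Lemma translation_inj : injective (@translation R n).
Proof. by move=> v w []. Qed.

Lemma translationMz v (c : int) : translation (v *~ c) = expgz (translation v) c.
Proof.
elim/expgz_ind: c => [|c IH|c IH]; first by rewrite mulr0z.
  by rewrite mulrzDr mulr1z translationD IH expgzS.
rewrite mulrzBr mulr1z translationD IH expgzP; congr (_ * _)%g.
by apply: (mulgI (translation v)); rewrite mulgV -translationD subrr.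
Qed.

Lemma translation_sum (r : nat) (e : 'I_r -> 'cV[R]_n) (c : 'I_r -> int) :
  translation (\sum_i e i *~ c i) = (\prod_i expgz (translation (e i)) (c i))%g.
Proof.
rewrite (big_morph _ translationD translation0).
by apply: eq_bigr => i _; rewrite translationMz.
Qed.

Lemma conj_translation g v :
  (g * translation v * g^-1)%g = translation (val g.2 *m v).
Proof.
apply/eqP; rewrite divg_eq; apply/eqP; case: g => w A.
rewrite -[LHS]/((w + val A *m v, (A * 1)%g) : euclidean_isom R n).
rewrite -[RHS]/((val A *m v + 1%:M *m w, (1 * A)%g) : euclidean_isom R n).
by rewrite mulg1 mul1g mul1mx addrC.
Qed.

Lemma translation_of g : g.2 = 1%g -> g = translation g.1.
Proof. by case: g => v A /= ->. Qed.

Lemma commute_translation g v : commute g (translation v) -> val g.2 *m v = v.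
Proof.
move=> gv; apply: translation_inj; rewrite -conj_translation.
by rewrite [(g * _)%g]gv mulgK.
Qed.

Lemma translation_commute v w : commute (translation v) (translation w).
Proof. by rewrite /commute -!translationD addrC. Qed.

Lemma mul_col (r : nat) (e : 'I_r -> 'cV[R]_n) (x : 'cV[R]_r) :
  (\matrix_(i, j) e j i 0) *m x = \sum_j x j 0 *: e j.
Proof.
apply/colP => i; rewrite mxE summxE; apply: eq_bigr => j _.
by rewrite !mxE mulrC.
Qed.

End Translations.

Section DiagonalCoordinates.
Variables (R : realType) (m : nat) (Gamma : groupClosed (euclidean_isom R m)).
Variable e : 'I_m -> 'cV[R]_m.
Hypothesis dG : discrete_subgroup Gamma.
Hypothesis eB : lattice_basis Gamma e.
Hypothesis eD : forall (g : euclidean_isom R m) (i : 'I_m), g \in Gamma ->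
  (g * translation (e i) * g^-1)%g = translation (e i) \/
  (g * translation (e i) * g^-1)%g = translation (- e i).

Lemma basis_translation (c : 'I_m -> int) : translation (\sum_i e i *~ c i) \in Gamma.
Proof. by apply/eB.1; exists c. Qed.

Let eI : forall x : 'I_m -> R, \sum_i x i *: e i = 0 -> forall i, x i = 0 :=
  discrete_independent dG basis_translation eB.2.

Definition basis_mx : 'M[R]_m := \matrix_(i, j) e j i 0.

Lemma basis_mx_unit : basis_mx \in unitmx.
Proof.
rewrite -unitmx_tr -row_free_unit; apply: inj_row_free => x xE.
have : basis_mx *m x^T = 0 by rewrite -[basis_mx]trmxK -trmx_mul xE trmx0.
rewrite mul_col => /eI x0; apply/rowP => i; rewrite mxE.
by have := x0 i; rewrite mxE.
Qed.

Definition basis_coord (v : 'cV[R]_m) (i : 'I_m) : R := (invmx basis_mx *m v) i 0.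

Lemma basis_coordE v : v = \sum_i basis_coord v i *: e i.
Proof. by rewrite -mul_col mulKVmx ?basis_mx_unit. Qed.

Lemma basis_coord_sum (x : 'I_m -> R) i : basis_coord (\sum_i x i *: e i) i = x i.
Proof.
have -> : \sum_i x i *: e i = basis_mx *m \col_i x i.
  by rewrite mul_col; apply: eq_bigr => j _; rewrite mxE.
by rewrite /basis_coord mulKmx ?basis_mx_unit // mxE.
Qed.

Lemma basis_coordD v w i : basis_coord (v + w) i = basis_coord v i + basis_coord w i.
Proof. by rewrite /basis_coord mulmxDr mxE. Qed.

Lemma basis_neq0 i : e i != 0.
Proof.
apply/eqP => e0; have := eI (x := fun j => (j == i)%:R).
rewrite (bigD1 i) //= e0 scaler0 add0r big1 => [/(_ erefl i)|j /negbTE ->].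
  by rewrite eqxx => /eqP; rewrite oner_eq0.
by rewrite scale0r.
Qed.

Definition holonomy_sign (g : euclidean_isom R m) (i : 'I_m) : bool :=
  val g.2 *m e i != e i.

Lemma holonomy_signE g i : g \in Gamma ->
  val g.2 *m e i = if holonomy_sign g i then - e i else e i.
Proof.
rewrite /holonomy_sign => gG; have := eD i gG; rewrite conj_translation.
case=> /translation_inj ->; first by rewrite eqxx.
by case: eqP => // ->.
Qed.

Lemma basis_coord_act g v i : g \in Gamma ->
  basis_coord (val g.2 *m v) i = rflip (holonomy_sign g i) (basis_coord v i).
Proof.
move=> gG; rewrite [in LHS](basis_coordE v) mulmx_sumr -[RHS](basis_coord_sum (fun j => rflip (holonomy_sign g j) (basis_coord v j))).
congr (basis_coord _ i); apply: eq_bigr => j _.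
by rewrite -scalemxAr holonomy_signE // /rflip; case: ifP => _; rewrite ?scaleNr ?scalerN.
Qed.

Lemma holonomy_signM g h i : g \in Gamma -> h \in Gamma ->
  holonomy_sign (g * h)%g i = holonomy_sign g i (+) holonomy_sign h i.
Proof.
move=> gG hG; rewrite {1}/holonomy_sign.
have -> : val (g * h)%g.2 *m e i = val g.2 *m (val h.2 *m e i) by exact: ortho_actM.
rewrite (holonomy_signE _ hG); case: (holonomy_sign h i); last first.
  by rewrite addbF.
rewrite mulmxN holonomy_signE //; case: (holonomy_sign g i); rewrite ?opprK ?eqxx //.
apply/eqP => ee; case/negP: (basis_neq0 i).
have : 2%:R *: e i = 0 by rewrite scaler_nat mulr2n -{1}ee addNr.
by move/eqP; rewrite scaler_eq0 pnatr_eq0.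
Qed.

Lemma holonomy_sign0 g : g \in Gamma -> (forall i, holonomy_sign g i = false) -> g.2 = 1%g.
Proof.
move=> gG s0; apply: val_inj; rewrite -[val g.2]mulmx1 -(mulmxV basis_mx_unit).
rewrite mulmxA; have -> : val g.2 *m basis_mx = basis_mx.
  apply/matrixP => i j.
  have /colP /(_ i) := holonomy_signE j gG; rewrite s0 => ej.
  rewrite [RHS]mxE -ej !mxE; apply: eq_bigr => k _; congr (_ * _).
  by rewrite mxE.
by rewrite mulmxV // basis_mx_unit.
Qed.

Lemma basis_coord_int (c : 'I_m -> int) i : basis_coord (\sum_i e i *~ c i) i = (c i)%:~R.
Proof.
rewrite -[RHS](basis_coord_sum (fun j => (c j)%:~R)); congr (basis_coord _ i).
by apply: eq_bigr => j _; rewrite scaler_int.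
Qed.

End DiagonalCoordinates.

(** * From a Bieberbach group of diagonal type to integral coordinates *)

Lemma Z2_neq1M (x y : 'Z_2) : ((x * y)%g != 1%g) = (x != 1%g) (+) (y != 1%g).
Proof. by case: x => [[|[|//]] ?]; case: y => [[|[|//]] ?]. Qed.

Section Holonomy.
Variables (R : realType) (n : nat) (Gamma : groupClosed (euclidean_isom R n)).
Hypothesis hC : isomorphic (holonomy_group Gamma) C2xC2.

Lemma holonomy_characters : exists (k1 k2 : subgroup Gamma -> bool)
    (gam : bool * bool -> subgroup Gamma),
  [/\ forall x y, k1 (x * y)%g = k1 x (+) k1 y,
      forall x y, k2 (x * y)%g = k2 x (+) k2 y,
      forall g, (~~ k1 g && ~~ k2 g) = (g \in lattice Gamma) &
      forall q, k1 (gam q) = q.1 /\ k2 (gam q) = q.2].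
Proof.
have [h [h' hK h'K]] := hC.
pose p (g : subgroup Gamma) : C2xC2 := h (\pi_(quotient_group (lattice Gamma)) g)%qT.
have pM x y : p (x * y)%g = (p x * p y)%g.
  rewrite /p -gmulfM; congr (h _); apply/esym.
  exact: (@quot_mulE _ (lattice Gamma) x y).
exists (fun g => (p g).1 != 1%g), (fun g => (p g).2 != 1%g).
(* The group law of ['Z_2] is addition, so its neutral element [1%g] is [0%R]. *)
pose z (b : bool) : 'Z_2 := if b then 1%R else 0%R.
exists (fun q => repr (h' (z q.1, z q.2))); split.
- by move=> x y; rewrite pM -Z2_neq1M.
- by move=> x y; rewrite pM -Z2_neq1M.
- move=> g; rewrite !negbK.
  have p1 : p 1%g = 1%g by exact: (morph_1 pM).
  have -> : ((p g).1 == 1%g) && ((p g).2 == 1%g) = (p g == p 1%g).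
    by rewrite p1.
  rewrite /p (inj_eq (can_inj hK)) eq_sym.
  apply/eqP/idP => [/(@quot_piE _ (lattice Gamma) 1%g g)|gl].
    by rewrite invg1 mul1g.
  by apply/(@quot_piE _ (lattice Gamma) 1%g g); rewrite invg1 mul1g.
- by move=> [q1 q2]; rewrite /p reprK h'K /=; case: q1; case: q2.
Qed.

End Holonomy.

Lemma diag_data_of_bieberbach (R : realType) (n : nat)
    (Gamma : groupClosed (euclidean_isom R n)) :
  bieberbach Gamma -> diagonal_type Gamma ->
  isomorphic (holonomy_group Gamma) C2xC2 ->
  inhabited (diag_data (subgroup Gamma) n).
Proof.
move=> [[dG cG] tf] [m [Gamma' [[dG' _] [f [f' fK f'K]] [e eB eD]]]].
move=> /holonomy_characters [k1 [k2 [gam [k1M k2M kL kgam]]]].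
have f'M : {morph f' : x y / (x * y)%g}.
  by move=> x y; apply: (can_inj fK); rewrite f'K gmulfM !f'K.
pose sg g := holonomy_sign e (val (f g)).
pose tr c : subgroup Gamma' :=
  exist (fun z => z \in Gamma') _ (basis_translation eB c).
pose cf i (j : 'I_m) : int := (j == i)%:Z.
have cfE i : \sum_j e j *~ cf i j = e i.
  rewrite (bigD1 i) //= /cf eqxx mulr1z big1 ?addr0 // => j /negbTE ->.
  by rewrite mulr0z.
have val_tr i : val (tr (cf i)) = translation (e i) by rewrite /= cfE.
(* Squares lie in the lattice of Gamma, so that an element of this lattice
   fixes twice each basis vector of the lattice of Gamma'. *)
have L_sub g : g \in lattice Gamma -> forall i, sg g i = false.
  move=> gL i; apply/negbTE; rewrite negbK; apply/eqP.
  pose x := f' (tr (cf i)).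
  have xL : (x * x)%g \in lattice Gamma by rewrite -kL k1M k2M !addbb.
  have gx : commute g (x * x)%g.
    apply/val_inj.
    have /eqP/translation_of e1 := gL; have /eqP/translation_of e2 := xL.
    by rewrite [LHS]valM [RHS]valM e1 e2; apply: translation_commute.
  have : commute (val (f g)) (translation (e i + e i)).
    rewrite translationD -val_tr -!valM -[tr _](f'K) -gmulfM.
    by rewrite /commute -!valM -!gmulfM [(g * _)%g]gx.
  move/commute_translation; rewrite mulmxDr => h.
  have : 2%:R *: (val (val (f g)).2 *m e i - e i) = 0.
    by rewrite scaler_nat mulr2n addrACA -opprD h subrr.
  by move/eqP; rewrite scaler_eq0 pnatr_eq0 /= subr_eq0 => /eqP.
have L'_f g : (forall i, sg g i = false) -> f g \in lattice Gamma'.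
  by move=> s0; apply/eqP/(holonomy_sign0 dG' eB eD) => //; apply: (valP (f g)).
have span (a : 'rV[R]_n) :
    (forall v, translation v \in Gamma -> a *m v = 0) -> a = 0.
  move=> av; apply: (@cocompact_functional0 R n Gamma k1 k2 k1M k2M _ gam _ _ a av cG).
  - by move=> g h1 h2; rewrite -kL h1 h2.
  - by move=> q; case: (kgam q).
  - by move=> q; case: (kgam q).
(* If [f g] is a translation, [g] commutes with the lattice of [Gamma]; its linear part fixes a
   spanning set and is the identity. *)
have L_sup g : (forall i, sg g i = false) -> g \in lattice Gamma.
  move=> s0; apply/eqP/val_inj/eqP; rewrite -subr_eq0; apply/eqP/row_matrixP => i.
  rewrite row0; apply: span => v vG; rewrite -row_mul mulmxBl.
  rewrite [X in _ - X]ortho_act1.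
  pose l : subgroup Gamma := exist (fun z => z \in Gamma) _ vG.
  have lL : l \in lattice Gamma by apply/eqP.
  have gl : commute (f g) (f l).
    have /eqP/translation_of e1 := L'_f _ s0.
    have /eqP/translation_of e2 := L'_f _ (L_sub _ lL).
    by apply/val_inj; rewrite [LHS]valM [RHS]valM e1 e2; apply: translation_commute.
  have gl' : commute g l by rewrite /commute; apply: (can_inj fK); rewrite !gmulfM.
  rewrite (_ : val (val g).2 *m v = v) ?subrr ?row0 //.
  by apply: commute_translation; rewrite /commute -[translation v]/(val l) -!valM gl'.
pose x i : subgroup Gamma := f' (tr (cf i)).
pose a i : 'cV[R]_n := (val (x i)).1.
have xL i : x i \in lattice Gamma.
  apply: L_sup => j; rewrite /sg f'K val_tr /holonomy_sign.
  by apply/negbTE; rewrite negbK /= mul1mx.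
have xE i : val (x i) = translation (a i) by apply: translation_of; apply/eqP/xL.
have trE c : val (f' (tr c)) = translation (\sum_i a i *~ c i).
  have -> : tr c = (\prod_i expgz (tr (cf i)) (c i))%g.
    apply/val_inj; rewrite /= translation_sum.
    rewrite (big_morph (val : subgroup Gamma' -> _) (@valM _ _ _) (@val1 _ _ _)).
    by apply: eq_bigr => i _; rewrite (morph_expgz (@valM _ _ _)) val_tr.
  rewrite translation_sum (big_morph f' f'M (morph_1 f'M)).
  rewrite (big_morph (val : subgroup Gamma -> _) (@valM _ _ _) (@val1 _ _ _)).
  by apply: eq_bigr => i _; rewrite (morph_expgz f'M) (morph_expgz (@valM _ _ _)) xE.
have aG c : translation (\sum_i a i *~ c i) \in Gamma by rewrite -trE; apply: (valP (f' (tr c))).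
have aZ (c : 'I_m -> int) : \sum_i a i *~ c i = 0 -> forall i, c i = 0.
  move=> ac; apply: eB.2; apply: translation_inj; rewrite translation0.
  have t1 : f' (tr c) = 1%g by apply/val_inj; rewrite trE ac.
  rewrite -[translation _]/(val (tr c)) -[tr c]f'K t1.
  by rewrite (morph_1 (@gmulfM _ _ f)).
have aI := discrete_independent dG aG aZ.
have aspan v : translation v \in Gamma -> exists c, v = \sum_i a i *~ c i.
  move=> vG; pose l : subgroup Gamma := exist (fun z => z \in Gamma) _ vG.
  have lL : l \in lattice Gamma by apply/eqP.
  have flE : val (f l) = translation (val (f l)).1.
    by apply: translation_of; apply/eqP/L'_f/L_sub.
  have [c hc] : exists c, (val (f l)).1 = \sum_i e i *~ c i.
    by apply/eB.1; rewrite -flE; apply: (valP (f l)).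
  exists c; apply: translation_inj; rewrite -trE -[LHS]/(val l); congr val.
  by rewrite -[l]fK; congr f'; apply/val_inj; rewrite flE hc.
pose A : 'M[R]_(n, m) := \matrix_(i, j) a j i 0.
(* The columns [a j] span R^n because they generate the lattice of [Gamma], and they are independent
   over R by discreteness. *)
have nm : n = m.
  apply/eqP; rewrite eqn_leq; apply/andP; split.
    have : row_free A.
      apply: inj_row_free => y yA; apply: span => v /aspan [c ->].
      rewrite mulmx_sumr big1 // => j _; rewrite -scaler_int -scalemxAr.
      suff -> : y *m a j = 0 by rewrite scaler0.
      have /rowP /(_ j) := yA; rewrite mxE [RHS]mxE => yj.
      apply/matrixP => i k; rewrite !ord1 [RHS]mxE -[RHS]yj mxE.
      by apply: eq_bigr => l _; rewrite [A l j]mxE.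
    by move=> /eqP <-; apply: rank_leq_col.
  have : row_free A^T.
    apply: inj_row_free => y yA.
    have : A *m y^T = 0 by rewrite -[A]trmxK -trmx_mul yA trmx0.
    rewrite mul_col => /aI y0; apply/rowP => i; rewrite mxE.
    by have := y0 i; rewrite mxE.
  by move=> /eqP <-; apply: rank_leq_col.
suff h : inhabited (diag_data (subgroup Gamma) m).
  exact: (eq_ind_r (fun q => inhabited (diag_data (subgroup Gamma) q)) h nm).
(* Holonomy characters come from [Gamma], but signs and translation parts are read in the diagonal
   basis of [Gamma']. *)
pose T g i := basis_coord e (val (f g)).1 i.
have fG g : val (f g) \in Gamma' by exact: (valP (f g)).
have ka q : k1 (gam q) = q.1 by case: (kgam q).
have kb q : k2 (gam q) = q.2 by case: (kgam q).
apply: (@diag_data_of_real R _ m k1 k2 sg T (gam (true, false)) (gam (false, true)));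
  rewrite ?ka ?kb //.
- by move=> g h i; rewrite /sg gmulfM (holonomy_signM dG' eB eD).
- move=> g h i; rewrite /T gmulfM.
  have -> : (val (f g * f h)%g).1 = (val (f g)).1 + val (val (f g)).2 *m (val (f h)).1 by [].
  by rewrite basis_coordD (basis_coord_act dG' eB eD).
- by move=> g i h1 h2; apply: L_sub; rewrite -kL h1 h2.
- move=> g i h1 h2.
  have gL : g \in lattice Gamma by rewrite -kL h1 h2.
  have flE : val (f g) = translation (val (f g)).1.
    by apply: translation_of; apply/eqP/L'_f/L_sub.
  have [c hc] : exists c, (val (f g)).1 = \sum_i e i *~ c i.
    by apply/eB.1; rewrite -flE.
  by exists (c i); rewrite /T hc (basis_coord_int dG' eB).
- move=> c; exists (f' (tr c)).
  have : f' (tr c) \in lattice Gamma by apply/eqP; rewrite trE.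
  rewrite -kL => /andP [-> ->]; split=> // i.
  by rewrite /T f'K (basis_coord_int dG' eB).
- move=> g h1 h2 T0.
  have gL : g \in lattice Gamma by rewrite -kL h1 h2.
  have flE : val (f g) = translation (val (f g)).1.
    by apply: translation_of; apply/eqP/L'_f/L_sub.
  apply: (can_inj fK); apply/val_inj; rewrite (morph_1 (@gmulfM _ _ f)) flE.
  rewrite (basis_coordE dG' eB (val (f g)).1) big1 // => i _.
  by have := T0 i; rewrite /T => ->; rewrite scale0r.
Qed.

Theorem theoremC (R : realType) (n k : nat) (Gamma : groupClosed (euclidean_isom R n)) :
  bieberbach Gamma ->
  diagonal_type Gamma ->
  isomorphic (holonomy_group Gamma) C2xC2 ->
  betti1 (subgroup Gamma) k ->
  (~ diffuse (subgroup Gamma) <->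
   (k + 3 <= n)%N /\
   exists phi : automorphic_action DeltaP 'rV[int]_(n - k - 3),
     isomorphic (subgroup Gamma)
       (subgroup (group_center (subgroup Gamma)) * sdprod phi)%type).
Proof.
move=> bG dG hG bk.
have [D] := diag_data_of_bieberbach bG dG hG.
split=> [nd|[_ [phi /isomorphic_sym [f [g fK _]]]]].
  rewrite (betti1_trivial D bk); apply: trivial_char_splitting => g i.
  move=> /andP [ai bi]; apply/negbTE/negP => pg; apply: nd.
  exact: diffuse_of_odd_trivial pg.
(* The complement in the semidirect product embeds the Promislow group, which carries its
   non-diffuseness to [Gamma]. *)
pose emb (d : DeltaP) : sdprod phi := (0, d).
have embM : {morph emb : x y / (x * y)%g}.
  move=> x y; rewrite /emb -[RHS]/((0 + phi x 0, (x * y)%g) : sdprod phi).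
  by rewrite act_0 addr0.
apply: (@nondiffuse_of_inj DeltaP _ (fun d => f (1%g, emb d))); last exact: DeltaP_nondiffuse.
  by move=> x y; rewrite embM -gmulfM; congr (f (_, _)); rewrite mulg1.
by move=> x y /(can_inj fK) [].
Qed.
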